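(* Let $n\in\mathbb{N}$, $\theta,\eta\in\mathbb{R}$, $\alpha,\gamma\in[0,2\pi)$ and $b\in(-1,1)$. Let $f_{b,\alpha}=h_{b,\alpha}+\overline{g_{b,\alpha}}\in S_H$ be given by $$h_{b,\alpha}(z)-e^{-2i\alpha}g_{b,\alpha}(z)=\frac{z}{1-ze^{i\alpha}},\qquad \frac{g_{b,\alpha}'(z)}{h_{b,\alpha}'(z)}=e^{2i\alpha}\left(\frac{b+ze^{i\alpha}}{1+bze^{i\alpha}}\right),$$ and let $t_{\eta,\gamma}=r_{\eta,\gamma}+\overline{s_{\eta,\gamma}}\in S_H$ be given by $$r_{\eta,\gamma}(z)-e^{-2i\gamma}s_{\eta,\gamma}(z)=f(z),\qquad \frac{s_{\eta,\gamma}'(z)}{r_{\eta,\gamma}'(z)}=e^{i\theta}z^n,$$ where $f$ is the analytic mapping in $\mathbb{D}$ given by $$zf'(z)=\frac{z}{(1+ze^{i(\eta+\gamma)})(1+ze^{-i(\eta-\gamma)})}.$$ Then $f_{b,\alpha}\,\tilde{\ast}\,t_{\eta,\gamma}\in S_H$ and is convex in the direction of $-(\alpha+\gamma)$ for all $b\in\left(-1,\frac{-(n-2)}{n+2}\right]$.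
   Context: $\mathbb{D}=\{z\in\mathbb{C}:|z|<1\}$. $S_H$ is the class of complex-valued univalent harmonic functions $f=h+\overline{g}$ in $\mathbb{D}$ ($h,g$ analytic in $\mathbb{D}$) normalized by $h(0)=g(0)=0=h'(0)-1$. The Hadamard product of analytic functions $z+\sum_{k\ge2}a_kz^k$ and $z+\sum_{k\ge2}A_kz^k$ is $z+\sum_{k\ge2}a_kA_kz^k$; in general $\ast$ denotes the coefficientwise product of power series. The convolution of harmonic mappings $h+\overline{g}$ and $H+\overline{G}$ is $(h+\overline{g})\,\tilde{\ast}\,(H+\overline{G})=h\ast H+\overline{g\ast G}$. A domain $E\subset\mathbb{C}$ is convex in the direction $\psi$ (directions taken modulo $\pi$) if every line parallel to the line through $0$ and $e^{i\psi}$ has an empty or connected intersection with $E$; a function is convex in the direction of $\psi$ if it maps $\mathbb{D}$ onto a domain convex in the direction $\psi$.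
   Formalization: The defining equations force h_{b,α}'(0)=1/(1-b), so f_{b,α} is in S_H only if b=0; membership in S_H for f_{b,α} and for the convolution is therefore proved with the normalization h'(0)=1 replaced by h'(0)=c for any c. *)

(* Defs.v *)
From Stdlib Require Import Reals Factorial.
From Coquelicot Require Import Coquelicot.
Open Scope R_scope.

(** Functions on the unit disc are total functions [C -> C]; only their values
    on [unit_disc] are ever constrained or used. *)
Definition unit_disc (z : C) : Prop := Cmod z < 1.

(** [cis t] is e^(it). *)
Definition cis (t : R) : C := (cos t, sin t).

Definition analytic (f : C -> C) : Prop :=
  forall z : C, unit_disc z ->
    @ex_derive C_AbsRing C_NormedModule f z.

Definition univalent (f : C -> C) : Prop :=
  forall z w : C, unit_disc z -> unit_disc w -> f z = f w -> z = w.

(** The pair (h, g) stands for the harmonic function h + conj g. *)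
Record harmonic_map : Type :=
  HMap { an_part : C -> C; coan_part : C -> C }.

Definition heval (f : harmonic_map) (z : C) : C :=
  (an_part f z + Cconj (coan_part f z))%C.

(** Univalent harmonic f = h + conj g with h(0) = g(0) = 0 and h'(0) = c; the
    class S_H is the case c = 1.  The value c is kept as a parameter because
    the two equations defining f_{b,alpha} give
      h'(0) - b h'(0) = 1,  i.e.  h'(0) = 1 / (1 - b),
    so f_{b,alpha} satisfies the normalization h'(0) = 1 only when b = 0, and
    for the other b it belongs to S_H only up to the positive factor 1 - b. *)
Definition in_SH_norm (c : C) (f : harmonic_map) : Prop :=
  analytic (an_part f) /\ analytic (coan_part f) /\ univalent (heval f) /\
  an_part f 0 = 0 /\ coan_part f 0 = 0 /\ C_derive (an_part f) 0 = c.

Definition in_SH (f : harmonic_map) : Prop := in_SH_norm 1 f.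

(** The (second complex) dilatation g'/h' of f = h + conj g is [w] on the
    disc; the nonvanishing of h' is what makes the quotient meaningful. *)
Definition has_dilatation (f : harmonic_map) (w : C -> C) : Prop :=
  forall z : C, unit_disc z ->
    C_derive (an_part f) z <> 0 /\
    (C_derive (coan_part f) z / C_derive (an_part f) z = w z)%C.

Fixpoint C_derive_n (f : C -> C) (k : nat) : C -> C :=
  match k with
  | O => f
  | S j => C_derive (C_derive_n f j)
  end.

Definition taylor_coef (f : C -> C) (k : nat) : C :=
  (C_derive_n f k 0 / RtoC (INR (fact k)))%C.

Definition C_series (a : nat -> C) : C :=
  (Series (fun k => Re (a k)), Series (fun k => Im (a k))).

(** Coefficientwise product of the power series of [f] and [F] at 0. *)
Definition hadamard (f F : C -> C) (z : C) : C :=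
  C_series (fun k => taylor_coef f k * taylor_coef F k * z ^ k)%C.

Definition harmonic_convolution (f F : harmonic_map) : harmonic_map :=
  HMap (hadamard (an_part f) (an_part F)) (hadamard (coan_part f) (coan_part F)).

Definition connected (E : C -> Prop) : Prop :=
  forall U V : C -> Prop,
    open U -> open V ->
    (forall z, E z -> U z \/ V z) ->
    (exists z, E z /\ U z) -> (exists z, E z /\ V z) ->
    exists z, E z /\ U z /\ V z.

Definition domain (E : C -> Prop) : Prop :=
  (exists z, E z) /\ open E /\ connected E.

(** The line through [p] parallel to the line through 0 and e^(i psi). *)
Definition line (psi : R) (p z : C) : Prop :=
  exists t : R, z = (p + RtoC t * cis psi)%C.

Definition convex_in_direction (psi : R) (E : C -> Prop) : Prop :=
  domain E /\
  forall p : C,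
    let S := fun z => E z /\ line psi p z in
    (forall z, ~ S z) \/ connected S.

Definition image_of_disc (f : C -> C) (w : C) : Prop :=
  exists z : C, unit_disc z /\ w = f z.

Definition map_convex_in_direction (psi : R) (f : harmonic_map) : Prop :=
  convex_in_direction psi (image_of_disc (heval f)).

(* Main.v *)
Require Import Defs.
From Stdlib Require Import Reals Lra Lia Arith ClassicalEpsilon.
From Stdlib Require Import FunctionalExtensionality PropExtensionality.
From Coquelicot Require Import Coquelicot.
Open Scope R_scope.

(** Up to the factor e^(-i(alpha+gamma)) / (1-b) and with u = e^(i(alpha+gamma)) z,
    the convolution is W = A + conj B, where A = a u rho' + d rho and
    B = a u sigma' - d sigma are built from the rotated parts rho, sigma of
    t_(eta,gamma), a = (1+b)/2, d = (1-b)/2, rho' = 1 / (Q (1-m)), sigma' = m rho',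
    Q = 1 + 2u cos eta + u^2 and m = mu u^n with |mu| = 1.  With
    p = (1-u^2)/Q and q = (1+m)/(1-m), of positive real parts, one finds
      B'/A' = m (Z-e)/(Z+e),  Z = a p + (an/2) q,  e = 1 - a - an/2,
      A' - B' = (a p + d q) / Q,
    and e >= 0 is exactly the bound on b, so |B'| < |A'|.

    Since Re W = Re (A+B) and Im W = Im (A-B), consider the level curves of
    V = Im (A-B).  The disc is swept out by the orbits of the vector field i Q;
    along each of them dV = Re (a p + d q) dt, so V increases at least as fast as
    a times the imaginary part of u/Q, which runs from -oo to +oo.  Hence every
    level curve of V is a graph crossing all the orbits, and along it Re W is
    strictly monotone because the Jacobian |A'|^2 - |B'|^2 is positive.  This
    gives univalence, openness of the image and connectedness of its horizontal
    slices at once, with no boundary behaviour of W involved. *)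

(** * Complex differentiation *)

(** Why the convolution is a differential operator: with w = z e^(i alpha), eliminating g' from the
    two equations for f_(b,alpha) gives (1-b) h' (1-w)^3 = 1 + b w = (a+d) + (a-d) w, the numerator
    of the series of (k+1)(a(k+1)+d) w^k. Up to rotation and the factor 1/(1-b), the Taylor
    coefficients of h and g are thus a k + d and a k - d, and multiplying coefficients by a k + d is
    the operator a u D + d.

    The field i Q is dictated by the shear: along it Im (A-B) grows at the rate Re ((A'-B') Q),
    which is positive, and Im (u/Q) at the rate Re p, whence the comparison between the two.

    Three choices keep the analysis elementary. The derivatives of h, g, r, s are explicit power
    series, so the expansions come from integration and not from Cauchy's formula. The orbits are
    parametrized rationally, by k instead of time, so that one formula covers the hyperbolic case
    |cos eta| < 1 and the parabolic case |cos eta| = 1. Level curves are handled by monotonicity and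
    the intermediate value theorem in one real variable. *)

Notation C_is_derive := (@is_derive C_AbsRing C_NormedModule).

Lemma C_is_derive_eps (f : C -> C) (z l : C) :
  C_is_derive f z l <->
  forall eps : posreal, exists delta : posreal, forall w : C,
    Cmod (w - z) < delta ->
    Cmod (f w - f z - (w - z) * l) <= eps * Cmod (w - z).
Proof.
  split.
  - intros [_ H] eps.
    destruct (H z (fun P HP => HP) eps) as [d Hd].
    exists d. intros w Hw. exact (Hd w Hw).
  - intros H. split.
    + apply is_linear_scal_l.
    + intros x Hx eps.
      rewrite <- (is_filter_lim_locally_unique (K := C_AbsRing)
                    (V := AbsRing_NormedModule C_AbsRing) z x Hx).
      destruct (H eps) as [d Hd].
      exists d. intros w Hw. exact (Hd w Hw).
Qed.

Lemma C_is_derive_continuous (f : C -> C) (z l : C) :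
  C_is_derive f z l ->
  forall eps : posreal, exists delta : posreal, forall w : C,
    Cmod (w - z) < delta -> Cmod (f w - f z) < eps.
Proof.
  intros H eps.
  destruct (proj1 (C_is_derive_eps f z l) H (mkposreal 1 Rlt_0_1)) as [d Hd].
  simpl in Hd.
  assert (Hl := Cmod_ge_0 l).
  assert (He : 0 < eps / (2 + Cmod l)).
  { apply Rdiv_lt_0_compat; [apply cond_pos | lra]. }
  assert (Hm : 0 < Rmin d (eps / (2 + Cmod l))).
  { apply Rmin_glb_lt; [apply cond_pos | exact He]. }
  exists (mkposreal _ Hm). simpl. intros w Hw.
  assert (H1 := Hd w (Rlt_le_trans _ _ _ Hw (Rmin_l _ _))).
  assert (H2 := Rlt_le_trans _ _ _ Hw (Rmin_r _ _)).
  assert (H3 : Cmod (f w - f z) <=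
               Cmod (f w - f z - (w - z) * l) + Cmod ((w - z) * l)).
  { eapply Rle_trans; [ | apply Cmod_triangle].
    right. f_equal. ring. }
  rewrite Cmod_mult in H3.
  assert (H4 : Cmod (w - z) * (2 + Cmod l) < eps).
  { apply (Rmult_lt_compat_r (2 + Cmod l)) in H2; [ | lra].
    unfold Rdiv in H2. rewrite Rmult_assoc, Rinv_l, Rmult_1_r in H2; lra. }
  assert (H0 := Cmod_ge_0 (w - z)). nra.
Qed.

(** The disc is open, so the derivatives there of a function constrained only on the disc are
    determined. *)
Lemma C_is_derive_ext_disc (f g : C -> C) (z l : C) :
  (forall w, unit_disc w -> f w = g w) -> unit_disc z ->
  C_is_derive f z l -> C_is_derive g z l.
Proof.
  intros Hfg Hz H. apply C_is_derive_eps. intros eps.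
  destruct (proj1 (C_is_derive_eps f z l) H eps) as [d Hd].
  unfold unit_disc in Hz.
  assert (Hm : 0 < Rmin d (1 - Cmod z)).
  { apply Rmin_glb_lt; [apply cond_pos | lra]. }
  exists (mkposreal _ Hm). simpl. intros w Hw.
  rewrite <- (Hfg z Hz), <- (Hfg w).
  - apply Hd. eapply Rlt_le_trans; [exact Hw | apply Rmin_l].
  - unfold unit_disc.
    assert (H2 := Rlt_le_trans _ _ _ Hw (Rmin_r _ _)).
    replace w with ((w - z) + z)%C by ring.
    eapply Rle_lt_trans; [apply Cmod_triangle | lra].
Qed.

Lemma analytic_is_derive (f : C -> C) (z : C) :
  analytic f -> unit_disc z -> C_is_derive f z (C_derive f z).
Proof.
  intros Hf Hz. apply C_derive_correct; [exact z | exact (Hf z Hz)].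
Qed.

Lemma C_derive_ext_disc (f g : C -> C) (z l : C) :
  (forall w, unit_disc w -> f w = g w) -> unit_disc z ->
  C_is_derive g z l -> C_derive f z = l.
Proof.
  intros Hfg Hz H. apply is_C_derive_unique.
  apply (C_is_derive_ext_disc g); auto. intros w Hw. symmetry. auto.
Qed.

Lemma im_le_Cmod (c : C) : Rabs (Im c) <= Cmod c.
Proof. eapply Rle_trans; [apply Rmax_r | apply Rmax_Cmod]. Qed.

Lemma Cmod_le_Re_Im (c : C) : Cmod c <= Rabs (Re c) + Rabs (Im c).
Proof.
  assert (H1 := Rabs_pos (Re c)). assert (H2 := Rabs_pos (Im c)).
  apply Rsqr_incr_0_var; [ | lra].
  unfold Rsqr. replace (Cmod c * Cmod c) with (Cmod c ^ 2) by ring.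
  rewrite Cmod2_alt, <- (pow2_abs (Re c)), <- (pow2_abs (Im c)). nra.
Qed.

Lemma unit_disc_0 : unit_disc 0.
Proof. unfold unit_disc. rewrite Cmod_0. lra. Qed.

Lemma unit_disc_convex (z w : C) (t : R) :
  unit_disc z -> unit_disc w -> 0 <= t <= 1 ->
  unit_disc (z + RtoC t * (w - z)).
Proof.
  unfold unit_disc. intros Hz Hw Ht.
  replace (z + RtoC t * (w - z))%C with (RtoC (1 - t) * z + RtoC t * w)%C
    by (rewrite RtoC_minus; ring).
  eapply Rle_lt_trans; [apply Cmod_triangle | ].
  rewrite !Cmod_mult, !Cmod_R, !Rabs_pos_eq by lra.
  destruct (Rle_lt_dec t (1 / 2)); nra.
Qed.

(** On the segment from 0 to [z] the real and imaginary parts are real functions with derivative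
    0. *)
Lemma constant_of_derive_zero (F : C -> C) :
  (forall z, unit_disc z -> C_is_derive F z (RtoC 0)) ->
  forall z, unit_disc z -> F z = F 0.
Proof.
  intros HF z Hz.
  assert (Hray : forall t eps, 0 <= t <= 1 -> 0 < eps -> exists d : posreal,
            forall x, Rabs (x - t) < d ->
              Cmod (F (RtoC x * z)%C - F (RtoC t * z)%C) <= eps * Rabs (x - t)).
  { intros t eps Ht Heps.
    assert (Hd : unit_disc (RtoC t * z)).
    { replace (RtoC t * z)%C with (0 + RtoC t * (z - 0))%C by ring.
      apply unit_disc_convex; auto using unit_disc_0. }
    destruct (proj1 (C_is_derive_eps _ _ _) (HF _ Hd) (mkposreal eps Heps))
      as [d Hd']. simpl in Hd'.
    exists d. intros x Hx.
    assert (E : (RtoC x * z - RtoC t * z)%C = (RtoC (x - t) * z)%C)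
      by (rewrite RtoC_minus; ring).
    assert (Hle : Cmod (RtoC x * z - RtoC t * z) <= Rabs (x - t)).
    { rewrite E, Cmod_mult, Cmod_R.
      unfold unit_disc in Hz. assert (Hp := Rabs_pos (x - t)). nra. }
    specialize (Hd' (RtoC x * z)%C (Rle_lt_trans _ _ _ Hle Hx)).
    replace (F (RtoC x * z)%C - F (RtoC t * z)%C -
             (RtoC x * z - RtoC t * z) * 0)%C
      with (F (RtoC x * z)%C - F (RtoC t * z)%C)%C in Hd' by ring.
    nra. }
  (* [part] stands for [Re] or [Im]. *)
  assert (Hcomp : forall part : C -> R,
            (forall c, Rabs (part c) <= Cmod c) ->
            (forall u v, part (u - v)%C = part u - part v) ->
            part (F z) = part (F 0)).
  { intros part Hpart Hsub.
    replace z with (RtoC 1 * z)%C at 1 by ring.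
    replace (F 0) with (F (RtoC 0 * z)%C) by (f_equal; ring).
    symmetry.
    apply (eq_is_derive (fun t => part (F (RtoC t * z)%C)) 0 1); [ | lra].
    intros t Ht. apply is_derive_Reals. intros eps Heps.
    destruct (Hray t (eps / 2) Ht ltac:(lra)) as [d Hd].
    exists d. intros h Hh Hhd.
    replace (zero : R) with 0 by reflexivity.
    rewrite Rminus_0_r, <- Hsub. unfold Rdiv. rewrite Rabs_mult, Rabs_inv.
    specialize (Hd (t + h)). replace (t + h - t) with h in Hd by ring.
    specialize (Hd Hhd).
    assert (Hh0 := Rabs_pos_lt h Hh).
    apply (Rmult_lt_reg_r (Rabs h)); [exact Hh0 | ].
    rewrite Rmult_assoc, Rinv_l, Rmult_1_r by lra.
    eapply Rle_lt_trans; [apply Hpart | ].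
    nra. }
  assert (HRe := Hcomp Re re_le_Cmod (fun _ _ => eq_refl)).
  assert (HIm := Hcomp Im im_le_Cmod (fun _ _ => eq_refl)).
  rewrite (surjective_pairing (F z)), (surjective_pairing (F 0)).
  unfold Re, Im in HRe, HIm. congruence.
Qed.

(** * Power series with polynomially bounded coefficients *)

(** [C_series] assigns a value to divergent series too; this relation carries the convergence,
    componentwise so that the theory of real series applies. *)
Definition is_Cseries (a : nat -> C) (l : C) : Prop :=
  is_series (fun k => Re (a k)) (Re l) /\ is_series (fun k => Im (a k)) (Im l).

Lemma is_Cseries_unique (a : nat -> C) (l : C) :
  is_Cseries a l -> C_series a = l.
Proof.
  intros [H1 H2]. unfold C_series.
  rewrite (is_series_unique _ _ H1), (is_series_unique _ _ H2).
  symmetry. apply surjective_pairing.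
Qed.

Lemma is_Cseries_ext (a b : nat -> C) (l : C) :
  (forall k, a k = b k) -> is_Cseries a l -> is_Cseries b l.
Proof.
  intros E [H1 H2]. split.
  - apply (is_series_ext (fun k => Re (a k))); auto. intros k. now rewrite E.
  - apply (is_series_ext (fun k => Im (a k))); auto. intros k. now rewrite E.
Qed.

Lemma is_Cseries_plus (a b : nat -> C) (la lb : C) :
  is_Cseries a la -> is_Cseries b lb ->
  is_Cseries (fun k => (a k + b k)%C) (la + lb)%C.
Proof.
  intros [H1 H2] [H3 H4].
  split; [exact (is_series_plus _ _ _ _ H1 H3) | exact (is_series_plus _ _ _ _ H2 H4)].
Qed.

Lemma is_Cseries_scal (c : C) (a : nat -> C) (l : C) :
  is_Cseries a l -> is_Cseries (fun k => (c * a k)%C) (c * l)%C.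
Proof.
  intros [H1 H2]. split.
  - exact (is_series_minus _ _ _ _ (is_series_scal (Re c) _ _ H1)
             (is_series_scal (Im c) _ _ H2)).
  - exact (is_series_plus _ _ _ _ (is_series_scal (Re c) _ _ H2)
             (is_series_scal (Im c) _ _ H1)).
Qed.

Lemma is_Cseries_minus (a b : nat -> C) (la lb : C) :
  is_Cseries a la -> is_Cseries b lb ->
  is_Cseries (fun k => (a k - b k)%C) (la - lb)%C.
Proof.
  intros [H1 H2] [H3 H4].
  split; [exact (is_series_minus _ _ _ _ H1 H3) | exact (is_series_minus _ _ _ _ H2 H4)].
Qed.

Lemma is_Cseries_incr (a : nat -> C) (l : C) :
  is_Cseries (fun k => a (S k)) l -> is_Cseries a (a 0%nat + l)%C.
Proof.
  intros [H1 H2]. split.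
  - apply is_series_decr_1.
    replace (plus _ _) with (Re l); [exact H1 | ].
    change (Re l = Re (a 0%nat) + Re l + - Re (a 0%nat)). ring.
  - apply is_series_decr_1.
    replace (plus _ _) with (Im l); [exact H2 | ].
    change (Im l = Im (a 0%nat) + Im l + - Im (a 0%nat)). ring.
Qed.

Lemma Cseries_abs_cv (a : nat -> C) (b : nat -> R) :
  (forall k, Cmod (a k) <= b k) -> ex_series b -> is_Cseries a (C_series a).
Proof.
  intros Hab Hb.
  split; apply Series_correct;
    apply (ex_series_le (K := R_AbsRing) (V := R_CompleteNormedModule) _ b);
    auto; intros k; (eapply Rle_trans; [ | apply Hab]);
    [apply re_le_Cmod | apply im_le_Cmod].
Qed.

(** The factor 2 pays for bounding the real and imaginary parts separately; a constant is harmless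
    where this is used, in a second-order remainder. *)
Lemma is_Cseries_bound (a : nat -> C) (b : nat -> R) (l : C) :
  (forall k, Cmod (a k) <= b k) -> ex_series b -> is_Cseries a l ->
  Cmod l <= 2 * Series b.
Proof.
  intros Hab Hb [H1 H2].
  assert (Hpart : forall (part : C -> R) (x : R),
            (forall c, Rabs (part c) <= Cmod c) ->
            is_series (fun k => part (a k)) x -> Rabs x <= Series b).
  { intros part x Hpart Hx.
    assert (Hle : forall k, Rabs (part (a k)) <= b k).
    { intros k. eapply Rle_trans; [apply Hpart | apply Hab]. }
    rewrite <- (is_series_unique _ _ Hx).
    eapply Rle_trans; [apply Series_Rabs | apply Series_le]; auto.
    - apply (ex_series_le (K := R_AbsRing) (V := R_CompleteNormedModule) _ b); auto.
      intros k. unfold norm; simpl. unfold abs; simpl. rewrite Rabs_Rabsolu. auto.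
    - intros k. split; [apply Rabs_pos | auto]. }
  eapply Rle_trans; [apply Cmod_le_Re_Im | ].
  assert (H3 := Hpart Re _ re_le_Cmod H1).
  assert (H4 := Hpart Im _ im_le_Cmod H2). lra.
Qed.

(** A growth class that forces convergence on the whole disc and is stable under every operation
    needed: termwise products (Hadamard), differentiation, integration, and division by 1 - lam z^m
    with |lam| <= 1. *)
Definition poly_bounded (c : nat -> C) : Prop :=
  exists (M : R) (p : nat), 0 <= M /\ forall k, Cmod (c k) <= M * (INR k + 1) ^ p.

(** Ratio test: consecutive values of (k+1)^p have a ratio tending to 1. *)
Lemma ex_series_poly_geom (p : nat) (r : R) :
  0 <= r < 1 -> ex_series (fun k => (INR k + 1) ^ p * r ^ k).
Proof.
  intros Hr.
  assert (Hpos : forall k, 0 < INR k + 1)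
    by (intros k; assert (H := pos_INR k); lra).
  assert (Hlim : is_lim_seq
            (fun k => Rabs ((INR (S k) + 1) ^ p / (INR k + 1) ^ p)) 1).
  { assert (Hb : is_lim_seq (fun k => 1 + / (INR k + 1)) 1).
    { replace (Finite 1) with (Rbar_plus 1 0) by (simpl; f_equal; ring).
      apply is_lim_seq_plus'; [apply is_lim_seq_const | ].
      replace (Finite 0) with (Rbar_inv p_infty) by reflexivity.
      apply is_lim_seq_inv; [ | discriminate].
      apply (is_lim_seq_ext (fun k => INR (S k))).
      - intros k. now rewrite S_INR.
      - apply -> is_lim_seq_incr_1. apply is_lim_seq_INR. }
    apply (is_lim_seq_ext (fun k => (1 + / (INR k + 1)) ^ p)).
    - intros k. rewrite S_INR. specialize (Hpos k).
      unfold Rdiv. rewrite <- pow_inv, <- Rpow_mult_distr.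
      replace ((INR k + 1 + 1) * / (INR k + 1)) with (1 + / (INR k + 1))
        by (field; lra).
      rewrite Rabs_pos_eq; [reflexivity | ].
      apply pow_le. assert (H := Rinv_0_lt_compat _ Hpos). lra.
    - clear -Hb. induction p as [ | p IH]; simpl.
      + apply is_lim_seq_const.
      + replace (Finite 1) with (Finite (1 * 1)) by (f_equal; ring).
        exact (is_lim_seq_mult' _ _ 1 1 Hb IH). }
  assert (Hcv : CV_disk (fun k => (INR k + 1) ^ p) r).
  { apply (CV_disk_DAlembert _ _ 1).
    - intros k. apply pow_nonzero. specialize (Hpos k). lra.
    - exact Hlim.
    - right. split; [lra | ]. rewrite Rabs_pos_eq, Rinv_1; lra. }
  unfold CV_disk in Hcv. eapply ex_series_ext; [ | exact Hcv].
  intros k. simpl. rewrite Rabs_pos_eq; [reflexivity | ].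
  apply Rmult_le_pos; apply pow_le; [specialize (Hpos k) | ]; lra.
Qed.

Definition power_series (c : nat -> C) (z : C) : C :=
  C_series (fun k => (c k * z ^ k)%C).

Lemma power_series_correct (c : nat -> C) (z : C) :
  poly_bounded c -> unit_disc z ->
  is_Cseries (fun k => (c k * z ^ k)%C) (power_series c z).
Proof.
  intros (M & p & HM & Hc) Hz.
  apply (Cseries_abs_cv _ (fun k => M * ((INR k + 1) ^ p * Cmod z ^ k))).
  - intros k. rewrite Cmod_mult, Cmod_pow, <- Rmult_assoc.
    apply Rmult_le_compat_r; [apply pow_le, Cmod_ge_0 | apply Hc].
  - apply (ex_series_scal (K := R_AbsRing) (V := R_NormedModule) M).
    apply ex_series_poly_geom. split; [apply Cmod_ge_0 | exact Hz].
Qed.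

Lemma power_series_ext (c d : nat -> C) (z : C) :
  (forall k, c k = d k) -> power_series c z = power_series d z.
Proof.
  intros E. unfold power_series, C_series.
  f_equal; apply Series_ext; intros k; now rewrite E.
Qed.

Lemma is_Cseries_zero : is_Cseries (fun _ => RtoC 0) 0.
Proof.
  assert (H0 : is_series (fun _ : nat => 0) 0).
  { change (is_lim_seq (sum_n (fun _ : nat => 0)) 0).
    apply (is_lim_seq_ext (fun _ => 0)); [ | apply is_lim_seq_const].
    intros k. rewrite sum_n_const. symmetry. apply Rmult_0_r. }
  split; exact H0.
Qed.

Lemma power_series_head (c : nat -> C) (z : C) :
  (forall k, c (S k) * z ^ S k = 0)%C -> power_series c z = c 0%nat.
Proof.
  intros H. apply is_Cseries_unique.
  replace (c 0%nat) with (c 0%nat * z ^ 0 + 0)%C by (simpl; ring).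
  apply (is_Cseries_incr (fun k => (c k * z ^ k)%C)).
  apply (is_Cseries_ext (fun _ => RtoC 0)); [ | exact is_Cseries_zero].
  intros k. symmetry. apply H.
Qed.

Lemma power_series_0 (c : nat -> C) : power_series c 0 = c 0%nat.
Proof. apply power_series_head. intros k. rewrite Cpow_S. ring. Qed.

Lemma power_series_scale_arg (c : nat -> C) (lam z : C) :
  power_series (fun k => c k * lam ^ k)%C z = power_series c (lam * z)%C.
Proof.
  unfold power_series, C_series.
  f_equal; apply Series_ext; intros k; rewrite Cpow_mult_l; f_equal; ring.
Qed.

Lemma power_series_scal (lam : C) (c : nat -> C) (z : C) :
  poly_bounded c -> unit_disc z ->
  power_series (fun k => lam * c k)%C z = (lam * power_series c z)%C.
Proof.
  intros Hc Hz. apply is_Cseries_unique.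
  eapply is_Cseries_ext; [ | exact (is_Cseries_scal lam _ _ (power_series_correct c z Hc Hz))].
  intros k. simpl. ring.
Qed.

Lemma power_series_plus (c d : nat -> C) (z : C) :
  poly_bounded c -> poly_bounded d -> unit_disc z ->
  power_series (fun k => c k + d k)%C z = (power_series c z + power_series d z)%C.
Proof.
  intros Hc Hd Hz. apply is_Cseries_unique.
  eapply is_Cseries_ext; [ | exact (is_Cseries_plus _ _ _ _
    (power_series_correct c z Hc Hz) (power_series_correct d z Hd Hz))].
  intros k. simpl. ring.
Qed.

(** * Shifting, differentiating and integrating coefficient sequences *)

Definition shift (c : nat -> C) (k : nat) : C :=
  match k with O => RtoC 0 | S j => c j end.

Definition shift_n (m : nat) (c : nat -> C) : nat -> C := Nat.iter m shift c.

Definition derive_coef (c : nat -> C) (k : nat) : C :=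
  (RtoC (INR (S k)) * c (S k))%C.

Definition int_coef (c : nat -> C) (k : nat) : C :=
  match k with O => RtoC 0 | S j => (c j / RtoC (INR (S j)))%C end.

Lemma poly_bounded_plus (c d : nat -> C) :
  poly_bounded c -> poly_bounded d -> poly_bounded (fun k => c k + d k)%C.
Proof.
  intros (M & p & HM & Hc) (N & q & HN & Hd).
  exists (M + N), (p + q)%nat. split; [lra | ]. intros k.
  assert (H1 : 1 <= INR k + 1) by (assert (H := pos_INR k); lra).
  assert (Hp := Rle_pow _ p (p + q) H1 ltac:(lia)).
  assert (Hq := Rle_pow _ q (p + q) H1 ltac:(lia)).
  specialize (Hc k). specialize (Hd k).
  eapply Rle_trans; [apply Cmod_triangle | ].
  assert (M * (INR k + 1) ^ p <= M * (INR k + 1) ^ (p + q)) by nra.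
  assert (N * (INR k + 1) ^ q <= N * (INR k + 1) ^ (p + q)) by nra.
  lra.
Qed.

Lemma poly_bounded_mult (c d : nat -> C) :
  poly_bounded c -> poly_bounded d -> poly_bounded (fun k => c k * d k)%C.
Proof.
  intros (M & p & HM & Hc) (N & q & HN & Hd).
  exists (M * N), (p + q)%nat. split; [nra | ]. intros k.
  rewrite Cmod_mult, pow_add.
  specialize (Hc k). specialize (Hd k).
  replace (M * N * ((INR k + 1) ^ p * (INR k + 1) ^ q))
    with ((M * (INR k + 1) ^ p) * (N * (INR k + 1) ^ q)) by ring.
  apply Rmult_le_compat; auto using Cmod_ge_0.
Qed.

Lemma poly_bounded_const (lam : C) : poly_bounded (fun _ => lam).
Proof.
  exists (Cmod lam), O. split; [apply Cmod_ge_0 | ]. intros k. simpl. lra.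
Qed.

Lemma poly_bounded_index : poly_bounded (fun k => RtoC (INR k)).
Proof.
  exists 1, 1%nat. split; [lra | ]. intros k.
  assert (H := pos_INR k). rewrite Cmod_R, Rabs_pos_eq; lra.
Qed.

Lemma poly_bounded_pow (lam : C) :
  Cmod lam <= 1 -> poly_bounded (fun k => lam ^ k)%C.
Proof.
  intros Hl. exists 1, O. split; [lra | ]. intros k. rewrite Cmod_pow. simpl.
  rewrite Rmult_1_r, <- (pow1 k). apply pow_incr. split; [apply Cmod_ge_0 | exact Hl].
Qed.

Lemma poly_bounded_shift (c : nat -> C) : poly_bounded c -> poly_bounded (shift c).
Proof.
  intros (M & p & HM & Hc). exists M, p. split; [exact HM | ].
  assert (Hp : forall k, 0 <= (INR k + 1) ^ p)
    by (intros k; apply pow_le; assert (H := pos_INR k); lra).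
  intros [ | k]; simpl shift.
  - rewrite Cmod_0. apply Rmult_le_pos; auto.
  - eapply Rle_trans; [apply Hc | ]. apply Rmult_le_compat_l; [exact HM | ].
    apply pow_incr. rewrite S_INR. assert (H := pos_INR k). lra.
Qed.

Lemma poly_bounded_shift_n (m : nat) (c : nat -> C) :
  poly_bounded c -> poly_bounded (shift_n m c).
Proof.
  intros Hc. induction m as [ | m IH]; simpl; auto using poly_bounded_shift.
Qed.

Lemma poly_bounded_derive (c : nat -> C) :
  poly_bounded c -> poly_bounded (derive_coef c).
Proof.
  intros (M & p & HM & Hc). exists (M * 2 ^ p), (S p).
  assert (H2 : 0 <= 2 ^ p) by (apply pow_le; lra).
  split; [nra | ]. intros k. unfold derive_coef.
  assert (H := pos_INR k).
  rewrite Cmod_mult, Cmod_R, Rabs_pos_eq, S_INR by apply pos_INR.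
  specialize (Hc (S k)). rewrite S_INR in Hc.
  assert (Hp : (INR k + 1 + 1) ^ p <= (2 * (INR k + 1)) ^ p)
    by (apply pow_incr; lra).
  rewrite Rpow_mult_distr in Hp. simpl.
  apply Rle_trans with ((INR k + 1) * (M * (2 ^ p * (INR k + 1) ^ p))).
  - apply Rmult_le_compat_l; [lra | ]. eapply Rle_trans; [exact Hc | ].
    apply Rmult_le_compat_l; lra.
  - right. ring.
Qed.

Lemma poly_bounded_int (c : nat -> C) :
  poly_bounded c -> poly_bounded (int_coef c).
Proof.
  intros (M & p & HM & Hc). exists M, p. split; [exact HM | ].
  assert (Hp : forall k, 0 <= (INR k + 1) ^ p)
    by (intros k; apply pow_le; assert (H := pos_INR k); lra).
  intros [ | k]; simpl int_coef.
  - rewrite Cmod_0. apply Rmult_le_pos; auto.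
  - assert (Hk := pos_INR k).
    assert (HS : 1 <= INR (S k)) by (rewrite S_INR; lra).
    change (match k with 0%nat => 1 | S _ => INR k + 1 end) with (INR (S k)).
    rewrite Cmod_div by (intros E; apply RtoC_inj in E; lra).
    rewrite Cmod_R, Rabs_pos_eq by lra.
    apply Rle_trans with (Cmod (c k)).
    + assert (H0 := Cmod_ge_0 (c k)). unfold Rdiv.
      assert (Hi : / INR (S k) <= 1) by (rewrite <- Rinv_1; apply Rinv_le_contravar; lra).
      nra.
    + eapply Rle_trans; [apply Hc | ]. apply Rmult_le_compat_l; [exact HM | ].
      apply pow_incr. rewrite S_INR. lra.
Qed.

Lemma power_series_shift (c : nat -> C) (z : C) :
  poly_bounded c -> unit_disc z ->
  power_series (shift c) z = (z * power_series c z)%C.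
Proof.
  intros Hc Hz. apply is_Cseries_unique.
  replace (z * power_series c z)%C
    with (shift c 0 * z ^ 0 + z * power_series c z)%C by (simpl; ring).
  apply (is_Cseries_incr (fun k => (shift c k * z ^ k)%C)).
  eapply is_Cseries_ext; [ | exact (is_Cseries_scal z _ _ (power_series_correct c z Hc Hz))].
  intros k. simpl shift. rewrite Cpow_S. simpl. ring.
Qed.

Lemma power_series_shift_n (m : nat) (c : nat -> C) (z : C) :
  poly_bounded c -> unit_disc z ->
  power_series (shift_n m c) z = (z ^ m * power_series c z)%C.
Proof.
  intros Hc Hz. induction m as [ | m IH].
  - simpl. ring.
  - change (shift_n (S m) c) with (shift (shift_n m c)).
    rewrite power_series_shift, IH, Cpow_S by auto using poly_bounded_shift_n. ring.
Qed.

(** The second-order remainder of z^k is at most k^2 r^(k-2) |w-z|^2; the factor r^2 stands on the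
    left to avoid the exponent k-2. *)
Lemma Cpow_diff_bound (r : R) (z w : C) (k : nat) :
  0 < r -> Cmod z <= r -> Cmod w <= r ->
  Cmod (w ^ k - z ^ k - (w - z) * (RtoC (INR k) * z ^ pred k)) * r ^ 2 <=
  INR k ^ 2 * r ^ k * Cmod (w - z) ^ 2.
Proof.
  intros Hr Hz Hw. induction k as [ | k IH].
  - simpl. replace (1 - 1 - (w - z) * (0 * 1))%C with (RtoC 0) by ring.
    rewrite Cmod_0. lra.
  - set (E := (w ^ k - z ^ k - (w - z) * (RtoC (INR k) * z ^ pred k))%C) in *.
    (* The remainder for k+1 is w times the one for k plus k z^(k-1) (w-z)^2, and k^2 + k <=
       (k+1)^2. *)
    replace (w ^ S k - z ^ S k - (w - z) * (RtoC (INR (S k)) * z ^ pred (S k)))%C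
      with (w * E + (RtoC (INR k) * z ^ pred k) * ((w - z) * (w - z)))%C.
    2: { unfold E. rewrite S_INR, RtoC_plus. simpl pred.
         destruct k as [ | k]; [simpl; ring | ]. simpl pred. rewrite !Cpow_S. ring. }
    assert (Hb : Cmod (RtoC (INR k) * z ^ pred k) * r <= INR k * r ^ k).
    { rewrite Cmod_mult, Cmod_R, Rabs_pos_eq by apply pos_INR.
      rewrite Cmod_pow, Rmult_assoc.
      destruct k as [ | k]; [simpl; lra | ].
      apply Rmult_le_compat_l; [apply pos_INR | ].
      simpl pred. rewrite Rmult_comm. simpl. apply Rmult_le_compat_l; [lra | ].
      apply pow_incr. split; [apply Cmod_ge_0 | exact Hz]. }
    eapply Rle_trans; [apply Rmult_le_compat_r; [nra | apply Cmod_triangle] | ].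
    rewrite !(Cmod_mult w), (Cmod_mult (RtoC (INR k) * _)), (Cmod_mult (w - z)).
    set (D := Cmod (w - z)) in *. set (F := Cmod (RtoC (INR k) * z ^ pred k)) in *.
    assert (HD : 0 <= D) by apply Cmod_ge_0.
    assert (HE : 0 <= Cmod E) by apply Cmod_ge_0.
    assert (Hk := pos_INR k).
    assert (Hrk : 0 <= r ^ k) by (apply pow_le; lra).
    assert (H1 : Cmod w * (Cmod E * r ^ 2) <= r * (INR k ^ 2 * r ^ k * D ^ 2)).
    { apply Rmult_le_compat; auto using Cmod_ge_0. apply Rmult_le_pos; [auto | nra]. }
    assert (H2 : (F * r) * (r * D ^ 2) <= (INR k * r ^ k) * (r * D ^ 2)).
    { apply Rmult_le_compat_r; [ | exact Hb]. apply Rmult_le_pos; nra. }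
    rewrite S_INR. simpl (r ^ S k).
    assert (H3 : 0 <= (INR k + 1) * (r ^ k * (r * D ^ 2))).
    { apply Rmult_le_pos; [lra | ]. apply Rmult_le_pos; [lra | ].
      apply Rmult_le_pos; nra. }
    nra.
Qed.

(** Summing the bounds of [Cpow_diff_bound] over all terms leaves a remainder that is quadratic in w
    - z. *)
Lemma is_derive_power_series (c : nat -> C) (z : C) :
  poly_bounded c -> unit_disc z ->
  C_is_derive (power_series c) z (power_series (derive_coef c) z).
Proof.
  intros Hc Hz. unfold unit_disc in Hz.
  (* A radius strictly between |z| and 1 bounds both z and all nearby w. *)
  set (r := (1 + Cmod z) / 2).
  assert (Hr : 0 < r < 1 /\ Cmod z < r)
    by (assert (H := Cmod_ge_0 z); unfold r; lra).
  destruct Hr as [Hr Hzr].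
  pose proof Hc as (M & p & HM & Hcb).
  set (b := fun k => M / r ^ 2 * ((INR k + 1) ^ (p + 2) * r ^ k)).
  assert (Hb : ex_series b).
  { apply (ex_series_scal (K := R_AbsRing) (V := R_NormedModule) (M / r ^ 2)).
    apply ex_series_poly_geom. lra. }
  assert (Hmain : forall w, Cmod w < r ->
    Cmod (power_series c w - power_series c z -
          (w - z) * power_series (derive_coef c) z) <=
    2 * Series b * Cmod (w - z) ^ 2).
  { intros w Hw.
    set (D := Cmod (w - z)).
    assert (HS : is_Cseries (fun k => c k * (w ^ k - z ^ k -
                   (w - z) * (RtoC (INR k) * z ^ pred k)))%C
              (power_series c w - power_series c z -
               (w - z) * power_series (derive_coef c) z)%C).
    (* The same series indexed from 0: the extra term vanishes through its factor [INR 0], so the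
       value of [pred 0] is harmless. *)
    { assert (Hd : is_Cseries (fun k => c k * (RtoC (INR k) * z ^ pred k))%C
                     (power_series (derive_coef c) z)).
      { replace (power_series (derive_coef c) z)
          with (c 0%nat * (RtoC (INR 0) * z ^ pred 0) +
                power_series (derive_coef c) z)%C by (simpl; ring).
        apply (is_Cseries_incr (fun k => c k * (RtoC (INR k) * z ^ pred k))%C).
        eapply is_Cseries_ext; [ | exact (power_series_correct (derive_coef c) z
                                     (poly_bounded_derive c Hc) Hz)].
        intros k. unfold derive_coef. simpl pred. ring. }
      assert (Hw1 : unit_disc w) by (unfold unit_disc; lra).
      eapply is_Cseries_ext; [ | exact (is_Cseries_minus _ _ _ _
        (is_Cseries_minus _ _ _ _ (power_series_correct c w Hc Hw1)
                                  (power_series_correct c z Hc Hz))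
        (is_Cseries_scal (w - z) _ _ Hd))].
      intros k. simpl. ring. }
    replace (2 * Series b * D ^ 2) with (2 * Series (fun k => b k * D ^ 2)).
    2: { rewrite Series_scal_r. ring. }
    refine (is_Cseries_bound _ _ _ _ _ HS).
    - intros k. cbv beta. rewrite Cmod_mult.
      assert (HP := Cpow_diff_bound r z w k ltac:(lra) ltac:(lra) ltac:(lra)).
      fold D in HP. set (E := Cmod (_ - _ - _)) in *.
      assert (Hr2 : 0 < r ^ 2) by nra.
      apply (Rmult_le_reg_r (r ^ 2)); [exact Hr2 | ].
      replace (b k * D ^ 2 * r ^ 2)
        with ((M * (INR k + 1) ^ p) * ((INR k + 1) ^ 2 * r ^ k * D ^ 2)).
      2: { unfold b. rewrite pow_add. field. lra. }
      rewrite Rmult_assoc. apply Rmult_le_compat.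
      + apply Cmod_ge_0.
      + apply Rmult_le_pos; [apply Cmod_ge_0 | lra].
      + apply Hcb.
      + eapply Rle_trans; [exact HP | ].
        apply Rmult_le_compat_r; [nra | ].
        apply Rmult_le_compat_r; [apply pow_le; lra | ].
        assert (H := pos_INR k). nra.
    - apply (ex_series_scal_r (D ^ 2)). exact Hb. }
  apply C_is_derive_eps. intros eps.
  assert (HB : 0 <= Series b).
  { replace 0 with (Series (fun _ => 0 * 0)) by (rewrite Series_scal_l; ring).
    apply Series_le; [ | exact Hb]. intros k.
    split; [lra | ]. rewrite Rmult_0_l. unfold b.
    assert (H := pos_INR k).
    apply Rmult_le_pos; [apply Rdiv_le_0_compat; nra | ].
    apply Rmult_le_pos; apply pow_le; lra. }
  assert (Hq : 0 < eps / (2 * Series b + 1)).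
  { apply Rdiv_lt_0_compat; [apply cond_pos | lra]. }
  assert (Hm : 0 < Rmin (r - Cmod z) (eps / (2 * Series b + 1)))
    by (apply Rmin_glb_lt; lra).
  exists (mkposreal _ Hm). simpl. intros w Hw.
  assert (H1 := Rlt_le_trans _ _ _ Hw (Rmin_l _ _)).
  assert (H2 := Rlt_le_trans _ _ _ Hw (Rmin_r _ _)).
  assert (Hwr : Cmod w < r).
  { replace w with ((w - z) + z)%C by ring.
    eapply Rle_lt_trans; [apply Cmod_triangle | lra]. }
  eapply Rle_trans; [exact (Hmain w Hwr) | ].
  apply (Rmult_lt_compat_r (2 * Series b + 1)) in H2; [ | lra].
  unfold Rdiv in H2. rewrite Rmult_assoc, Rinv_l, Rmult_1_r in H2 by lra.
  assert (H0 := Cmod_ge_0 (w - z)). simpl. rewrite Rmult_1_r. nra.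
Qed.

Lemma shift_n_lt (m : nat) (c : nat -> C) (k : nat) :
  (k < m)%nat -> shift_n m c k = 0.
Proof.
  revert k. induction m as [ | m IH]; intros k Hk; [lia | ].
  change (shift (shift_n m c) k = 0). destruct k as [ | k]; [reflexivity | ].
  simpl. apply IH. lia.
Qed.

Lemma shift_n_add (m : nat) (c : nat -> C) (k : nat) :
  shift_n m c (m + k) = c k.
Proof. induction m as [ | m IH]; [reflexivity | exact IH]. Qed.

Lemma power_series_mult_binomial (m : nat) (lam : C) (c : nat -> C) (z : C) :
  poly_bounded c -> unit_disc z ->
  power_series (fun k => c k - lam * shift_n m c k)%C z =
  (power_series c z * (1 - lam * z ^ m))%C.
Proof.
  intros Hc Hz.
  assert (Hs := poly_bounded_shift_n m c Hc).
  rewrite (power_series_ext _ (fun k => c k + (- lam) * shift_n m c k)%C)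
    by (intros k; ring).
  rewrite (power_series_plus c (fun k => (- lam) * shift_n m c k)%C), power_series_scal,
    power_series_shift_n; auto.
  - ring.
  - apply poly_bounded_mult; auto using poly_bounded_const.
Qed.

(* The coefficients solve [d k = c k + lam * d (k - m)]; the recursion is run
   with [k] as its fuel. *)
Lemma power_series_div_binomial (m : nat) (lam : C) (c : nat -> C) :
  (0 < m)%nat -> Cmod lam <= 1 -> poly_bounded c ->
  exists d, poly_bounded d /\ forall z, unit_disc z ->
    (power_series d z * (1 - lam * z ^ m))%C = power_series c z.
Proof.
  intros Hm Hlam (M & p & HM & Hc).
  set (it := fun N => Nat.iter N
               (fun (d : nat -> C) k => (c k + lam * shift_n m d k)%C) c).
  assert (Hstep : forall N k, it (S N) k = (c k + lam * shift_n m (it N) k)%C)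
    by reflexivity.
  (* Entry k depends only on entry k - m, and m > 0, so every round settles at least one more
     coefficient. *)
  assert (Hstab : forall N k, (k <= N)%nat -> it (S N) k = it N k).
  { induction N as [ | N IH]; intros k Hk.
    - rewrite Hstep, shift_n_lt by lia. simpl. ring.
    - rewrite (Hstep (S N)), (Hstep N). do 2 f_equal.
      destruct (Nat.lt_ge_cases k m) as [H | H].
      + now rewrite !shift_n_lt.
      + replace k with (m + (k - m))%nat by lia.
        rewrite !shift_n_add. apply IH. lia. }
  assert (Hdiag : forall N k, (k <= N)%nat -> it N k = it k k).
  { induction N as [ | N IH]; intros k Hk.
    - now replace k with 0%nat by lia.
    - destruct (Nat.eq_dec k (S N)) as [-> | H]; [reflexivity | ].
      rewrite Hstab by lia. apply IH. lia. }
  set (d := fun k => it k k).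
  assert (Hd : forall k, d k = (c k + lam * shift_n m d k)%C).
  { intros k. unfold d at 1. rewrite <- (Hstab k k), Hstep by lia. do 2 f_equal.
    destruct (Nat.lt_ge_cases k m) as [H | H].
    - now rewrite !shift_n_lt.
    - replace k with (m + (k - m))%nat at 2 3 by lia.
      rewrite !shift_n_add. apply Hdiag. lia. }
  (* Division costs one degree: by induction d k is at most M (k+1)^p + M k (k+1)^p = M
     (k+1)^(p+1). *)
  assert (Hpb : poly_bounded d).
  { exists M, (S p). split; [exact HM | ].
    intros k. induction k as [k IH] using (well_founded_ind lt_wf). rewrite Hd.
    assert (Hk := pos_INR k).
    eapply Rle_trans; [apply Cmod_triangle | ]. rewrite Cmod_mult.
    assert (H1 : Cmod (shift_n m d k) <= M * (INR k * (INR k + 1) ^ p)).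
    { destruct (Nat.lt_ge_cases k m) as [H | H].
      - rewrite shift_n_lt, Cmod_0 by lia.
        apply Rmult_le_pos; [lra | ]. apply Rmult_le_pos; [lra | ].
        apply pow_le. lra.
      - replace k with (m + (k - m))%nat at 1 by lia. rewrite shift_n_add.
        eapply Rle_trans; [apply IH; lia | ].
        apply Rmult_le_compat_l; [exact HM | ].
        assert (Hi : INR (k - m) + 1 <= INR k).
        { rewrite <- S_INR. apply le_INR. lia. }
        assert (Hi0 := pos_INR (k - m)). simpl.
        apply Rmult_le_compat; [lra | apply pow_le; lra | lra | ].
        apply pow_incr. lra. }
    specialize (Hc k). simpl. assert (H0 := Cmod_ge_0 (shift_n m d k)).
    assert (H2 : Cmod lam * Cmod (shift_n m d k) <= Cmod (shift_n m d k)) by nra.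
    nra. }
  exists d. split; [exact Hpb | ]. intros z Hz.
  rewrite <- power_series_mult_binomial by auto.
  apply power_series_ext. intros k. rewrite (Hd k) at 1. ring.
Qed.

(** * Expansions from known derivatives, and Taylor coefficients *)

Lemma derive_int_coef (c : nat -> C) (k : nat) : derive_coef (int_coef c) k = c k.
Proof.
  unfold derive_coef, int_coef. field.
  intros E. apply RtoC_inj in E. assert (H := pos_INR k). rewrite S_INR in E. lra.
Qed.

(** The difference of the two sides has derivative 0 and vanishes at 0. This is how h, g, r, s get
    their expansions. *)
Lemma primitive_power_series (f : C -> C) (c : nat -> C) :
  analytic f -> f 0 = 0 -> poly_bounded c ->
  (forall z, unit_disc z -> C_derive f z = power_series c z) ->
  forall z, unit_disc z -> f z = power_series (int_coef c) z.
Proof.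
  intros Hf H0 Hc Hd z Hz.
  assert (Hi := poly_bounded_int c Hc).
  assert (HF := constant_of_derive_zero
                  (fun w => f w - power_series (int_coef c) w)%C).
  assert (E : (f z - power_series (int_coef c) z =
               f 0 - power_series (int_coef c) 0)%C).
  { apply HF; [ | exact Hz]. intros w Hw.
    replace (RtoC 0) with
      (C_derive f w - power_series (derive_coef (int_coef c)) w)%C.
    - apply (is_derive_minus (K := C_AbsRing) (V := C_NormedModule) f);
        [now apply analytic_is_derive | now apply is_derive_power_series].
    - rewrite Hd by exact Hw.
      rewrite (power_series_ext (derive_coef (int_coef c)) c) by apply derive_int_coef. ring. }
  rewrite H0, power_series_0 in E. simpl in E.
  replace (f z) with (f z - power_series (int_coef c) z +
                      power_series (int_coef c) z)%C by ring.
  rewrite E. ring.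
Qed.

(** Entry j of the k-th derivative is (k+j)!/j! c_(k+j), cleared of the division so that the
    induction stays polynomial. *)
Lemma iter_derive_coef (c : nat -> C) (k j : nat) :
  (Nat.iter k derive_coef c j * RtoC (INR (fact j)))%C =
  (c (k + j)%nat * RtoC (INR (fact (k + j))))%C.
Proof.
  revert j. induction k as [ | k IH]; intros j; [reflexivity | ].
  change (Nat.iter (S k) derive_coef c j)
    with (RtoC (INR (S j)) * Nat.iter k derive_coef c (S j))%C.
  replace (S k + j)%nat with (k + S j)%nat by lia. rewrite <- IH.
  rewrite (fact_simpl j), mult_INR, RtoC_mult. ring.
Qed.

(** Connects the iterated derivatives in [taylor_coef] with known coefficients. The induction
    compares derivatives on the whole disc, since values at 0 alone could not be differentiated
    again. *)
Lemma taylor_coef_power_series (f : C -> C) (c : nat -> C) :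
  poly_bounded c -> (forall z, unit_disc z -> f z = power_series c z) ->
  forall k, taylor_coef f k = c k.
Proof.
  intros Hc Hf k.
  assert (Hk : poly_bounded (Nat.iter k derive_coef c) /\
    forall z, unit_disc z -> C_derive_n f k z = power_series (Nat.iter k derive_coef c) z).
  { induction k as [ | k [IH1 IH2]]; [split; auto | ].
    simpl. split; [now apply poly_bounded_derive | ].
    intros z Hz. apply (C_derive_ext_disc _ _ z _ IH2 Hz).
    now apply is_derive_power_series. }
  unfold taylor_coef. rewrite (proj2 Hk 0 unit_disc_0), power_series_0.
  assert (E := iter_derive_coef c k 0). rewrite Nat.add_0_r in E.
  simpl (fact 0) in E. simpl INR in E.
  replace (Nat.iter k derive_coef c 0%nat) with (c k * RtoC (INR (fact k)))%C
    by (rewrite <- E; ring).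
  field. intros E'. apply RtoC_inj in E'. exact (INR_fact_neq_0 k E').
Qed.

Definition one_coef (k : nat) : C := match k with O => RtoC 1 | S _ => RtoC 0 end.

Lemma poly_bounded_one : poly_bounded one_coef.
Proof.
  exists 1, O. split; [lra | ].
  intros [ | k]; simpl; rewrite ?Cmod_0, ?Cmod_1; lra.
Qed.

Lemma power_series_one (z : C) : power_series one_coef z = 1.
Proof. apply (power_series_head one_coef). intros k. simpl. ring. Qed.

Lemma poly_bounded_quadratic (a d : C) :
  poly_bounded (fun k => RtoC (INR (S k)) * (a * RtoC (INR (S k)) + d))%C.
Proof.
  assert (HS : poly_bounded (fun k => RtoC (INR (S k)))).
  { destruct (poly_bounded_plus _ _ poly_bounded_index (poly_bounded_const 1))
      as (M & p & HM & H).
    exists M, p. split; [exact HM | ]. intros k.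
    rewrite S_INR, RtoC_plus. apply H. }
  apply poly_bounded_mult; [exact HS | ].
  apply poly_bounded_plus; [ | apply poly_bounded_const].
  apply poly_bounded_mult; [apply poly_bounded_const | exact HS].
Qed.

(* Third differences of the quadratic polynomial [(k+1)(a(k+1)+d)] vanish. *)
Lemma power_series_quadratic (a d z : C) :
  unit_disc z ->
  (power_series (fun k => RtoC (INR (S k)) * (a * RtoC (INR (S k)) + d))%C z *
     (1 - z) ^ 3)%C = ((a + d) + (a - d) * z)%C.
Proof.
  intros Hz.
  set (c := fun k => (RtoC (INR (S k)) * (a * RtoC (INR (S k)) + d))%C).
  set (D := fun (e : nat -> C) k => (e k - 1 * shift_n 1 e k)%C).
  assert (HDp : forall e, poly_bounded e -> poly_bounded (D e)).
  { intros e He. unfold D.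
    destruct (poly_bounded_plus _ _ He (poly_bounded_mult _ _
                (poly_bounded_const (- (1))) (poly_bounded_shift_n 1 e He)))
      as (M & p & HM & H).
    exists M, p. split; [exact HM | ]. intros k.
    replace (e k - 1 * shift_n 1 e k)%C
      with (e k + - (1) * shift_n 1 e k)%C by ring. apply H. }
  assert (HD : forall e, poly_bounded e ->
             power_series (D e) z = (power_series e z * (1 - z))%C).
  { intros e He. unfold D. rewrite power_series_mult_binomial by auto.
    simpl. ring. }
  assert (Hc : poly_bounded c) by apply poly_bounded_quadratic.
  assert (E : power_series (D (D (D c))) z = (power_series c z * (1 - z) ^ 3)%C).
  { rewrite !HD by auto. simpl. ring. }
  rewrite <- E.
  rewrite (power_series_ext _ (fun k => (a + d) * one_coef k +
                                        (a - d) * shift one_coef k)%C).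
  - assert (Ho := poly_bounded_one). assert (Hs := poly_bounded_shift _ Ho).
    rewrite (power_series_plus (fun k => (a + d) * one_coef k)%C
               (fun k => (a - d) * shift one_coef k)%C),
      !power_series_scal, power_series_shift, power_series_one; auto.
    + ring.
    + apply poly_bounded_mult; auto using poly_bounded_const.
    + apply poly_bounded_mult; auto using poly_bounded_const.
  (* Indices 0, 1 and 2 see the shifts cut off at 0. Index 2 already gives 0, because the polynomial
     also vanishes at k = -1. *)
  - intros [ | [ | [ | k]]]; unfold D, c;
      cbn -[INR RtoC Cmult Cplus Cminus Copp];
      rewrite ?S_INR, ?RtoC_plus; change (INR 0) with 0; ring.
Qed.

(** * Connectedness by paths, and level curves of plane maps *)

(** The balls of the product uniform structure on [C] are squares; half the radius fits a square
    into a disc. *)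
Lemma open_Cmod (U : C -> Prop) :
  open U <-> forall z, U z ->
    exists eps : posreal, forall w, Cmod (w - z) < eps -> U w.
Proof.
  split.
  - intros HU z Hz. destruct (HU z Hz) as [eps He].
    exists eps. intros w Hw. apply He.
    now apply C_NormedModule_mixin_compat1.
  - intros HU z Hz. destruct (HU z Hz) as [eps He].
    exists (pos_div_2 eps). intros w [H1 H2]. apply He.
    change (Rabs (fst w - fst z) < eps / 2) in H1.
    change (Rabs (snd w - snd z) < eps / 2) in H2.
    eapply Rle_lt_trans; [apply Cmod_le_Re_Im | ].
    change (Rabs (fst w - fst z) + Rabs (snd w - snd z) < eps). lra.
Qed.

(** The path must stay in [E] near every s in [0, 1], hence slightly beyond both ends: the indicator
    of [U] along it then has a two-sided derivative, equal to 0, at every point of the closed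
    interval. *)
Lemma path_connected (E : C -> Prop) :
  (forall z w, E z -> E w -> exists p : R -> C,
     p 0 = z /\ p 1 = w /\
     forall s, 0 <= s <= 1 ->
       (exists d : posreal, forall s', Rabs (s' - s) < d -> E (p s')) /\
       (forall eps : posreal, exists d : posreal,
          forall s', Rabs (s' - s) < d -> Cmod (p s' - p s) < eps)) ->
  connected E.
Proof.
  intros HE U V HU HV Hcov [z [Ez Uz]] [w [Ew Vw]].
  apply NNPP. intros Hdisj.
  assert (HUV : forall x, E x -> U x -> V x -> False) by (intros x ? ? ?; eauto 7).
  destruct (HE z w Ez Ew) as (p & Hp0 & Hp1 & Hp).
  (* [phi] is the locally constant indicator of [U] along the path. *)
  set (phi := fun s => if excluded_middle_informative (U (p s)) then 1 else 0).
  assert (Hphi : phi 0 = phi 1).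
  { apply (eq_is_derive phi 0 1); [ | lra]. intros s Hs.
    destruct (Hp s Hs) as [[d1 H1] H2].
    assert (Hnear : forall W : C -> Prop, open W -> W (p s) ->
              exists d : posreal, forall s', Rabs (s' - s) < d ->
                E (p s') /\ W (p s')).
    { intros W HW Ws. destruct (proj1 (open_Cmod W) HW _ Ws) as [e He].
      destruct (H2 e) as [d2 Hd2].
      assert (Hm : 0 < Rmin d1 d2) by (apply Rmin_glb_lt; apply cond_pos).
      exists (mkposreal _ Hm). simpl. intros s' Hs'. split.
      - apply H1. eapply Rlt_le_trans; [exact Hs' | apply Rmin_l].
      - apply He, Hd2. eapply Rlt_le_trans; [exact Hs' | apply Rmin_r]. }
    assert (Es : E (p s)).
    { apply H1. rewrite Rminus_diag, Rabs_R0. apply cond_pos. }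
    assert (Hconst : forall v, (exists d : posreal, forall s', Rabs (s' - s) < d ->
              phi s' = v) -> is_derive phi s zero).
    { intros v [d Hd]. apply (is_derive_ext_loc (fun _ => v)).
      - exists d. intros s' Hs'. symmetry. apply Hd. exact Hs'.
      - apply (is_derive_const (K := R_AbsRing) (V := R_NormedModule)). }
    destruct (Hcov _ Es) as [Us | Vs].
    - destruct (Hnear U HU Us) as [d Hd].
      apply (Hconst 1). exists d. intros s' Hs'. unfold phi.
      destruct (Hd s' Hs'). destruct excluded_middle_informative; tauto.
    - destruct (Hnear V HV Vs) as [d Hd].
      apply (Hconst 0). exists d. intros s' Hs'. unfold phi.
      destruct (Hd s' Hs').
      destruct excluded_middle_informative; [ | reflexivity].
      exfalso. eauto. }
  unfold phi in Hphi. rewrite Hp0, Hp1 in Hphi.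
  destruct excluded_middle_informative as [_ | H]; [ | tauto].
  destruct excluded_middle_informative as [H | _]; [eauto | lra].
Qed.

Lemma differentiable_pt_lim_slice (f : R -> R -> R) (x y lx ly : R) :
  differentiable_pt_lim f x y lx ly -> derivable_pt_lim (fun v => f x v) y ly.
Proof.
  intros H. replace ly with (lx * 0 + ly * 1) by ring.
  apply (derivable_pt_lim_comp_2d f (fun _ => x) (fun v => v)).
  - exact H.
  - apply derivable_pt_lim_const.
  - apply derivable_pt_lim_id.
Qed.

Lemma differentiable_pt_lim_near (f : R -> R -> R) (x y lx ly : R) :
  differentiable_pt_lim f x y lx ly ->
  forall eps, 0 < eps -> exists d, 0 < d /\ forall u v,
    Rabs (u - x) < d -> Rabs (v - y) < d -> Rabs (f u v - f x y) < eps.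
Proof.
  intros H eps Heps.
  assert (Hc : continuity_2d_pt f x y).
  { apply differentiable_continuity_pt. exists lx, ly. exact H. }
  destruct (Hc (mkposreal eps Heps)) as [d Hd].
  exists d. split; [apply cond_pos | exact Hd].
Qed.

(** * Plane maps (X, V) with V strictly increasing and unbounded in k *)

Section Level_curves.

Variables (V X Vt Vk Xt Xk : R -> R -> R) (ta tb : R) (J : R -> Prop).

Hypothesis J_convex : forall x y z, J x -> J z -> x <= y <= z -> J y.
Hypothesis J_open : forall x, J x ->
  exists d, 0 < d /\ forall y, Rabs (y - x) < d -> J y.
Hypothesis V_diff : forall t k, ta < t < tb -> J k ->
  differentiable_pt_lim V t k (Vt t k) (Vk t k).
Hypothesis X_diff : forall t k, ta < t < tb -> J k ->
  differentiable_pt_lim X t k (Xt t k) (Xk t k).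
Hypothesis Vk_pos : forall t k, ta < t < tb -> J k -> 0 < Vk t k.
Hypothesis jacobian_pos : forall t k, ta < t < tb -> J k ->
  0 < Xt t k * Vk t k - Xk t k * Vt t k.
Hypothesis V_low : forall t c, ta < t < tb -> exists k, J k /\ V t k < c.
Hypothesis V_high : forall t c, ta < t < tb -> exists k, J k /\ c < V t k.

Lemma V_increasing (t k1 k2 : R) :
  ta < t < tb -> J k1 -> J k2 -> k1 < k2 -> V t k1 < V t k2.
Proof.
  intros Ht H1 H2 H12.
  destruct (MVT_cor2 (V t) (Vk t) k1 k2 H12) as (k & E & Hk).
  - intros k Hk. apply (differentiable_pt_lim_slice _ _ _ (Vt t k)).
    apply V_diff; [exact Ht | apply (J_convex k1 k k2); auto].
  - assert (Hp : 0 < Vk t k).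
    { apply Vk_pos; [exact Ht | apply (J_convex k1 k k2); auto; lra]. }
    nra.
Qed.

Lemma V_lt_reg (t k1 k2 : R) :
  ta < t < tb -> J k1 -> J k2 -> V t k1 < V t k2 -> k1 < k2.
Proof.
  intros Ht H1 H2 H. destruct (Rtotal_order k1 k2) as [L | [-> | L]]; [exact L | lra | ].
  assert (H' := V_increasing t k2 k1 Ht H2 H1 L). lra.
Qed.

(** [V_low] and [V_high] make every level curve pass over every t; the rest is the intermediate
    value theorem in k. *)
Lemma level_exists (c t : R) : ta < t < tb -> exists k, J k /\ V t k = c.
Proof.
  intros Ht.
  destruct (V_low t c Ht) as (k1 & J1 & H1).
  destruct (V_high t c Ht) as (k2 & J2 & H2).
  assert (H12 : k1 < k2) by (apply (V_lt_reg t); auto; lra).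
  destruct (Ranalysis5.IVT_interv (fun k => V t k - c) k1 k2) as (k & Hk & E).
  - intros k Hk. apply derivable_continuous_pt. exists (Vk t k - 0).
    apply (derivable_pt_lim_minus (V t) (fun _ => c)).
    + apply (differentiable_pt_lim_slice _ _ _ (Vt t k)).
      apply V_diff; [exact Ht | apply (J_convex k1 k k2); auto].
    + apply derivable_pt_lim_const.
  - exact H12.
  - lra.
  - lra.
  - exists k. split; [apply (J_convex k1 k k2); auto | lra].
Qed.

(** The level curve V = c as a graph over t. A total function is needed for differentiation; its
    values for t outside (ta, tb) are arbitrary. *)
Definition level (c t : R) : R := epsilon (inhabits 0) (fun k => J k /\ V t k = c).

Lemma level_spec (c t : R) : ta < t < tb -> J (level c t) /\ V t (level c t) = c.
Proof.
  intros Ht.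
  exact (epsilon_spec (inhabits 0) (fun k => J k /\ V t k = c) (level_exists c t Ht)).
Qed.

Lemma level_unique (t k : R) : ta < t < tb -> J k -> level (V t k) t = k.
Proof.
  intros Ht Hk. destruct (level_spec (V t k) t Ht) as [HJ HV].
  destruct (Rtotal_order (level (V t k) t) k) as [L | [E | L]]; [ | exact E | ];
    apply (V_increasing t) in L; auto; lra.
Qed.

(** The strict inequalities V t (k-e) < c < V t (k+e) survive small changes of t and c and trap the
    new level value between k-e and k+e. *)
Lemma level_continuous (c t : R) : ta < t < tb ->
  forall eps, 0 < eps -> exists d, 0 < d /\ forall c' t', ta < t' < tb ->
    Rabs (c' - c) < d -> Rabs (t' - t) < d ->
    Rabs (level c' t' - level c t) < eps.
Proof.
  intros Ht eps Heps.
  destruct (level_spec c t Ht) as [HJ HV]. set (k := level c t) in *.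
  destruct (J_open k HJ) as (dJ & HdJ & HJ').
  set (e := Rmin eps dJ / 2).
  assert (He : 0 < e /\ e < eps /\ e < dJ).
  { unfold e. assert (H1 := Rmin_l eps dJ). assert (H2 := Rmin_r eps dJ).
    assert (H3 : 0 < Rmin eps dJ) by now apply Rmin_glb_lt. lra. }
  assert (J1 : J (k - e)).
  { apply HJ'. replace (k - e - k) with (- e) by ring.
    rewrite Rabs_Ropp, Rabs_pos_eq; lra. }
  assert (J2 : J (k + e)).
  { apply HJ'. replace (k + e - k) with e by ring. rewrite Rabs_pos_eq; lra. }
  assert (V1 : V t (k - e) < c) by (rewrite <- HV; apply V_increasing; auto; lra).
  assert (V2 : c < V t (k + e)) by (rewrite <- HV; apply V_increasing; auto; lra).
  (* Half of the smaller gap: one g absorbs the change of V, the other the change of c. *)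
  set (g := Rmin (c - V t (k - e)) (V t (k + e) - c) / 2).
  assert (Hg : 0 < g /\ 2 * g <= c - V t (k - e) /\ 2 * g <= V t (k + e) - c).
  { unfold g. assert (H1 := Rmin_l (c - V t (k - e)) (V t (k + e) - c)).
    assert (H2 := Rmin_r (c - V t (k - e)) (V t (k + e) - c)).
    assert (0 < Rmin (c - V t (k - e)) (V t (k + e) - c)) by (apply Rmin_glb_lt; lra).
    lra. }
  destruct (differentiable_pt_lim_near _ _ _ _ _ (V_diff t _ Ht J1) g ltac:(lra))
    as (d1 & Hd1 & H1).
  destruct (differentiable_pt_lim_near _ _ _ _ _ (V_diff t _ Ht J2) g ltac:(lra))
    as (d2 & Hd2 & H2).
  exists (Rmin g (Rmin d1 d2)). split.
  { repeat apply Rmin_glb_lt; lra. }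
  intros c' t' Ht' Hc' Htt.
  assert (M1 := Rmin_l g (Rmin d1 d2)). assert (M2 := Rmin_r g (Rmin d1 d2)).
  assert (M3 := Rmin_l d1 d2). assert (M4 := Rmin_r d1 d2).
  specialize (H1 t' (k - e) ltac:(lra)).
  specialize (H2 t' (k + e) ltac:(lra)).
  rewrite Rminus_diag, Rabs_R0 in H1, H2.
  specialize (H1 Hd1). specialize (H2 Hd2).
  apply Rabs_def2 in H1, H2, Hc'.
  destruct (level_spec c' t' Ht') as [HJc HVc].
  assert (L1 : k - e < level c' t') by (apply (V_lt_reg t'); auto; lra).
  assert (L2 : level c' t' < k + e) by (apply (V_lt_reg t'); auto; lra).
  apply Rabs_def1; lra.
Qed.

(** Implicit differentiation of V t (level c t) = c. The first-order expansion is used twice: with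
    error vk/2 it gives a Lipschitz bound for the level curve, which then turns an arbitrarily small
    error in |h| + |D| into one in |h| alone. *)
Lemma level_derivable (c t : R) : ta < t < tb ->
  derivable_pt_lim (level c) t (- Vt t (level c t) / Vk t (level c t)).
Proof.
  intros Ht.
  destruct (level_spec c t Ht) as [HJ HV]. set (k := level c t) in *.
  assert (Hk := Vk_pos t k Ht HJ). assert (Hdiff := V_diff t k Ht HJ).
  set (vt := Vt t k) in *. set (vk := Vk t k) in *.
  assert (Hnear : forall e, 0 < e -> exists d, 0 < d /\ forall h, Rabs h < d ->
            ta < t + h < tb /\
            Rabs (vt * h + vk * (level c (t + h) - k)) <=
            e * (Rabs h + Rabs (level c (t + h) - k))).
  { intros e He. destruct (Hdiff (mkposreal e He)) as [d Hd]. simpl in Hd.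
    destruct (level_continuous c t Ht d (cond_pos d)) as (d' & Hd' & Hlev).
    exists (Rmin (Rmin d d') (Rmin (t - ta) (tb - t))).
    split; [repeat apply Rmin_glb_lt; try apply cond_pos; lra | ].
    intros h Hh.
    assert (M1 := Rmin_l (Rmin d d') (Rmin (t - ta) (tb - t))).
    assert (M2 := Rmin_r (Rmin d d') (Rmin (t - ta) (tb - t))).
    assert (M3 := Rmin_l d d'). assert (M4 := Rmin_r d d').
    assert (M5 := Rmin_l (t - ta) (tb - t)). assert (M6 := Rmin_r (t - ta) (tb - t)).
    assert (Hth : ta < t + h < tb).
    { assert (Hh' := Rabs_def2 h _ Hh). lra. }
    split; [exact Hth | ].
    assert (Eh : t + h - t = h) by ring.
    specialize (Hd (t + h) (level c (t + h))). rewrite Eh in Hd.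
    destruct (level_spec c (t + h) Hth) as [HJh HVh].
    rewrite HVh, HV in Hd.
    replace (Rabs (vt * h + vk * (level c (t + h) - k)))
      with (Rabs (c - c - (vt * h + vk * (level c (t + h) - k)))).
    2: { rewrite <- Rabs_Ropp. f_equal. ring. }
    eapply Rle_trans; [apply Hd | ].
    - lra.
    - apply Hlev; [exact Hth | | rewrite Eh; lra].
      rewrite Rminus_diag, Rabs_R0. exact Hd'.
    - apply Rmult_le_compat_l; [lra | ].
      apply Rmax_lub; assert (A1 := Rabs_pos h);
        assert (A2 := Rabs_pos (level c (t + h) - k)); lra. }
  (* From vk |D| <= vk/2 (|h| + |D|) + |vt| |h|, solved for |D|. *)
  set (K := 2 * Rabs vt / vk + 1).
  assert (HK : 0 < K).
  { unfold K. assert (0 <= 2 * Rabs vt / vk); [ | lra].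
    apply Rdiv_le_0_compat; [ | exact Hk]. assert (A := Rabs_pos vt). lra. }
  destruct (Hnear (vk / 2) ltac:(lra)) as (d0 & Hd0 & H0).
  intros eps Heps.
  assert (He : 0 < eps * vk / (2 * (1 + K))).
  { apply Rdiv_lt_0_compat; [nra | lra]. }
  destruct (Hnear _ He) as (d1 & Hd1 & H1).
  assert (Hm : 0 < Rmin d0 d1) by now apply Rmin_glb_lt.
  exists (mkposreal _ Hm). simpl. intros h Hh0 Hh.
  destruct (H0 h (Rlt_le_trans _ _ _ Hh (Rmin_l _ _))) as [_ B0].
  destruct (H1 h (Rlt_le_trans _ _ _ Hh (Rmin_r _ _))) as [_ B1].
  set (D := level c (t + h) - k) in *.
  assert (Hhp := Rabs_pos_lt h Hh0). assert (HDp := Rabs_pos D).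
  assert (HDK : Rabs D <= K * Rabs h).
  { assert (T : vk * Rabs D <= Rabs (vt * h + vk * D) + Rabs vt * Rabs h).
    { rewrite <- (Rabs_pos_eq vk) at 1 by lra. rewrite <- !Rabs_mult.
      replace (vk * D) with ((vt * h + vk * D) + - (vt * h)) at 1 by ring.
      eapply Rle_trans; [apply Rabs_triang | ]. rewrite Rabs_Ropp. lra. }
    apply (Rmult_le_reg_l (vk / 2)); [lra | ].
    replace (vk / 2 * (K * Rabs h)) with (Rabs vt * Rabs h + vk / 2 * Rabs h)
      by (unfold K; field; lra).
    lra. }
  change (Rabs (D / h - - vt / vk) < eps).
  replace (D / h - - vt / vk) with ((vt * h + vk * D) / (vk * h))
    by (field; split; lra).
  unfold Rdiv at 1. rewrite Rabs_mult, Rabs_inv, Rabs_mult, (Rabs_pos_eq vk) by lra.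
  assert (Hvh : 0 < vk * Rabs h) by nra.
  apply (Rmult_lt_reg_r (vk * Rabs h)); [exact Hvh | ].
  rewrite Rmult_assoc, Rinv_l, Rmult_1_r by lra.
  eapply Rle_lt_trans; [exact B1 | ].
  apply Rle_lt_trans with (eps * vk / (2 * (1 + K)) * ((1 + K) * Rabs h)).
  - apply Rmult_le_compat_l; lra.
  - replace (eps * vk / (2 * (1 + K)) * ((1 + K) * Rabs h))
      with (eps * vk * Rabs h / 2) by (field; lra).
    assert (0 < eps * vk * Rabs h) by (apply Rmult_lt_0_compat; nra). lra.
Qed.

Definition along (c t : R) : R := X t (level c t).

(** By the chain rule the derivative is the Jacobian divided by [Vk]. *)
Lemma along_derivable (c t : R) : ta < t < tb ->
  exists l, 0 < l /\ derivable_pt_lim (along c) t l.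
Proof.
  intros Ht. destruct (level_spec c t Ht) as [HJ HV].
  assert (Hk := Vk_pos _ _ Ht HJ). assert (Hj := jacobian_pos _ _ Ht HJ).
  set (k := level c t) in *.
  exists (Xt t k * 1 + Xk t k * (- Vt t k / Vk t k)). split.
  - replace (Xt t k * 1 + Xk t k * (- Vt t k / Vk t k))
      with ((Xt t k * Vk t k - Xk t k * Vt t k) / Vk t k) by (field; lra).
    now apply Rdiv_lt_0_compat.
  - apply (derivable_pt_lim_comp_2d X (fun s => s) (level c)).
    + now apply X_diff.
    + apply derivable_pt_lim_id.
    + now apply level_derivable.
Qed.

Lemma along_increasing (c t1 t2 : R) :
  ta < t1 -> t1 < t2 -> t2 < tb -> along c t1 < along c t2.
Proof.
  intros H1 H12 H2.
  (* The mean value theorem takes the derivative as a function, hence the choice by [epsilon]. *)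
  destruct (MVT_cor2 (along c)
    (fun t => epsilon (inhabits 0) (fun l => 0 < l /\ derivable_pt_lim (along c) t l))
    t1 t2 H12) as (t & E & Ht).
  - intros t Ht.
    exact (proj2 (epsilon_spec (inhabits 0) _ (along_derivable c t ltac:(lra)))).
  - assert (Hp := proj1 (epsilon_spec (inhabits 0) _ (along_derivable c t ltac:(lra)))).
    cbv beta in Hp. nra.
Qed.

(** Equal values of V put both points on one level curve, along which X is strictly increasing. *)
Lemma shear_injective (t1 k1 t2 k2 : R) :
  ta < t1 < tb -> J k1 -> ta < t2 < tb -> J k2 ->
  X t1 k1 = X t2 k2 -> V t1 k1 = V t2 k2 -> t1 = t2 /\ k1 = k2.
Proof.
  intros Ht1 Hk1 Ht2 Hk2 EX EV.
  assert (L1 := level_unique t1 k1 Ht1 Hk1). assert (L2 := level_unique t2 k2 Ht2 Hk2).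
  rewrite <- EV in L2. set (c := V t1 k1) in *.
  assert (A : along c t1 = along c t2) by (unfold along; now rewrite L1, L2).
  assert (t1 = t2).
  { destruct (Rtotal_order t1 t2) as [L | [E | L]]; [ | exact E | ];
      apply (along_increasing c) in L; lra. }
  subst t2. split; [reflexivity | congruence].
Qed.

Lemma along_continuous_level (c t : R) : ta < t < tb ->
  forall eps, 0 < eps -> exists d, 0 < d /\
    forall c', Rabs (c' - c) < d -> Rabs (along c' t - along c t) < eps.
Proof.
  intros Ht eps Heps. destruct (level_spec c t Ht) as [HJ HV].
  destruct (differentiable_pt_lim_near _ _ _ _ _ (X_diff t _ Ht HJ) eps Heps)
    as (d & Hd & H).
  destruct (level_continuous c t Ht d Hd) as (d' & Hd' & H').
  exists d'. split; [exact Hd' | ]. intros c' Hc'.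
  apply H.
  - rewrite Rminus_diag, Rabs_R0. exact Hd.
  - apply H'; auto. rewrite Rminus_diag, Rabs_R0. exact Hd'.
Qed.

Lemma along_continuous (c t : R) : ta < t < tb -> continuity_pt (along c) t.
Proof.
  intros Ht. destruct (along_derivable c t Ht) as (l & _ & Hl).
  apply derivable_continuous_pt. now exists l.
Qed.

(** On the level curve through the point, X takes a smaller value at [t1] and a larger one at [t2].
    Both inequalities persist on nearby level curves, and each of these attains x in between. *)
Lemma shear_open (t k : R) : ta < t < tb -> J k ->
  exists d, 0 < d /\ forall x y,
    Rabs (x - X t k) < d -> Rabs (y - V t k) < d ->
    exists t' k', ta < t' < tb /\ J k' /\ X t' k' = x /\ V t' k' = y.
Proof.
  intros Ht Hk. assert (L := level_unique t k Ht Hk). set (c := V t k) in *.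
  set (t1 := (ta + t) / 2). set (t2 := (t + tb) / 2).
  assert (H1 : ta < t1 < tb) by (unfold t1; lra).
  assert (H2 : ta < t2 < tb) by (unfold t2; lra).
  assert (S1 : along c t1 < along c t) by (apply along_increasing; unfold t1; lra).
  assert (S2 : along c t < along c t2) by (apply along_increasing; unfold t2; lra).
  set (g := Rmin (along c t - along c t1) (along c t2 - along c t) / 2).
  assert (Hg : 0 < g /\ 2 * g <= along c t - along c t1 /\
               2 * g <= along c t2 - along c t).
  { unfold g.
    assert (M1 := Rmin_l (along c t - along c t1) (along c t2 - along c t)).
    assert (M2 := Rmin_r (along c t - along c t1) (along c t2 - along c t)).
    assert (0 < Rmin (along c t - along c t1) (along c t2 - along c t))
      by (apply Rmin_glb_lt; lra).
    lra. }
  destruct (along_continuous_level c t1 H1 g ltac:(lra)) as (d1 & Hd1 & C1).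
  destruct (along_continuous_level c t2 H2 g ltac:(lra)) as (d2 & Hd2 & C2).
  exists (Rmin g (Rmin d1 d2)). split; [repeat apply Rmin_glb_lt; lra | ].
  intros x y Hx Hy.
  assert (M1 := Rmin_l g (Rmin d1 d2)). assert (M2 := Rmin_r g (Rmin d1 d2)).
  assert (M3 := Rmin_l d1 d2). assert (M4 := Rmin_r d1 d2).
  specialize (C1 y ltac:(lra)). specialize (C2 y ltac:(lra)).
  replace (X t k) with (along c t) in Hx by (unfold along; now rewrite L).
  apply Rabs_def2 in C1, C2, Hx.
  destruct (Ranalysis5.IVT_interv (fun s => along y s - x) t1 t2) as (t' & Ht' & E).
  - intros s Hs. apply continuity_pt_minus.
    + apply along_continuous. lra.
    + apply continuity_pt_const. intros ? ?. reflexivity.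
  - unfold t1, t2. lra.
  - lra.
  - lra.
  - exists t', (level y t'). assert (Ht'' : ta < t' < tb) by lra.
    destruct (level_spec y t' Ht'') as [HJ' HV'].
    repeat split; auto; try lra. unfold along in E. lra.
Qed.

End Level_curves.

(** * The disc as a union of orbits *)

Lemma C_eq (z w : C) : Re z = Re w -> Im z = Im w -> z = w.
Proof.
  unfold Re, Im. intros H1 H2.
  rewrite (surjective_pairing z), (surjective_pairing w). congruence.
Qed.

Lemma unit_disc_sqr (z : C) : unit_disc z <-> Re z ^ 2 + Im z ^ 2 < 1.
Proof.
  rewrite <- Cmod2_alt. unfold unit_disc. assert (H := Cmod_ge_0 z).
  split; intros; nra.
Qed.

Lemma Re_mult_conj_pos_neq_0 (x y : C) : 0 < Re (x * Cconj y) -> y <> 0.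
Proof.
  intros H ->. assert (E : (x * Cconj 0)%C = 0).
  { unfold Cconj. simpl. apply C_eq; simpl; ring. }
  rewrite E in H. simpl in H. lra.
Qed.

Lemma Re_div (x y : C) : y <> 0 -> Re (x / y) = Re (x * Cconj y) / Cmod y ^ 2.
Proof.
  intros Hy.
  assert (H : Cmod y ^ 2 <> 0).
  { apply pow_nonzero. apply Cmod_gt_0 in Hy. lra. }
  rewrite Cmod2_alt in *. destruct x as [x1 x2], y as [y1 y2]. simpl in *.
  field. lra.
Qed.

Lemma Re_div_pos (x y : C) : 0 < Re (x * Cconj y) -> 0 < Re (x / y).
Proof.
  intros H. assert (Hy := Re_mult_conj_pos_neq_0 x y H).
  rewrite Re_div by exact Hy. apply Rdiv_lt_0_compat; [exact H | ].
  apply pow_lt. now apply Cmod_gt_0.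
Qed.

Lemma Re_half_plane_map_pos (m : C) : unit_disc m -> 0 < Re ((1 + m) / (1 - m)).
Proof.
  intros Hm. apply Re_div_pos. apply unit_disc_sqr in Hm.
  destruct m as [m1 m2]. simpl in *. nra.
Qed.

Definition quad (cs : R) (u : C) : C := (1 + 2 * RtoC cs * u + u * u)%C.

(** The real part factors as (1 - |u|^2)(1 + |u|^2 + 2 cs x), and the second factor is at least (1 -
    |x|)^2. The product form also shows that [quad] has no zero in the disc. *)
Lemma quad_pos (cs : R) (u : C) : -1 <= cs <= 1 -> unit_disc u ->
  0 < Re ((1 - u * u) * Cconj (quad cs u)).
Proof.
  intros Hc Hu. apply unit_disc_sqr in Hu. unfold quad.
  destruct u as [x y]. simpl in *.
  replace (_ - _) with ((1 - (x ^ 2 + y ^ 2)) * (1 + x ^ 2 + y ^ 2 + 2 * cs * x)) by ring.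
  apply Rmult_lt_0_compat; [lra | ].
  assert (Hx : -1 < x < 1) by nra. destruct (Rle_lt_dec 0 x); nra.
Qed.

Lemma quad_neq_0 (cs : R) (u : C) : -1 <= cs <= 1 -> unit_disc u -> quad cs u <> 0.
Proof. intros. eapply Re_mult_conj_pos_neq_0. now apply quad_pos. Qed.

Lemma Re_quad_quotient_pos (cs : R) (u : C) : -1 <= cs <= 1 -> unit_disc u ->
  0 < Re ((1 - u * u) / quad cs u).
Proof. intros. apply Re_div_pos. now apply quad_pos. Qed.

(* For fixed [t] in (-1, 1) the curve [k |-> chi t k] is the orbit of [t] under
   the flow of the vector field [i (1 + 2 cs u + u^2)], up to a change of time:
   exp (s N) for N = i [[cs, 1], [-1, -cs]] is cosh (s r) I + sinh (s r) / r N,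
   where r^2 = 1 - cs^2, and k stands for tanh (s r) / r. *)
Definition chi_num (cs t k : R) : C := (t, k * (1 + cs * t)).
Definition chi_den (cs t k : R) : C := (1, - k * (t + cs)).
Definition chi (cs t k : R) : C := (chi_num cs t k / chi_den cs t k)%C.

Definition chi_dt (cs t k : R) : C :=
  (RtoC (1 - (1 - cs ^ 2) * k ^ 2) / (chi_den cs t k * chi_den cs t k))%C.
Definition chi_dk (cs t k : R) : C :=
  (Ci * RtoC (1 + 2 * cs * t + t ^ 2) / (chi_den cs t k * chi_den cs t k))%C.

Lemma chi_den_ge_1 (cs t k : R) : 1 <= Cmod (chi_den cs t k).
Proof.
  eapply Rle_trans; [ | apply re_le_Cmod]. simpl. rewrite Rabs_R1. lra.
Qed.

Lemma chi_den_neq_0 (cs t k : R) : chi_den cs t k <> 0.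
Proof. intros E. assert (H := chi_den_ge_1 cs t k). rewrite E, Cmod_0 in H. lra. Qed.

Lemma chi_modulus (cs t k : R) :
  Re (chi_den cs t k) ^ 2 + Im (chi_den cs t k) ^ 2 -
  (Re (chi_num cs t k) ^ 2 + Im (chi_num cs t k) ^ 2) =
  (1 - t ^ 2) * (1 - (1 - cs ^ 2) * k ^ 2).
Proof. simpl. ring. Qed.

(** By [chi_modulus], |den|^2 - |num|^2 splits into a factor in t and a factor in k. One range of k
    therefore serves all t, an interval that becomes the whole line when cs^2 = 1. *)
Lemma chi_in_disc (cs t k : R) : -1 < t < 1 ->
  (unit_disc (chi cs t k) <-> (1 - cs ^ 2) * k ^ 2 < 1).
Proof.
  intros Ht. assert (H := chi_modulus cs t k).
  rewrite <- !Cmod2_alt in H. unfold unit_disc, chi.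
  rewrite Cmod_div by apply chi_den_neq_0.
  assert (H1 := chi_den_ge_1 cs t k). assert (H0 := Cmod_ge_0 (chi_num cs t k)).
  set (p := Cmod (chi_num cs t k)) in *. set (q := Cmod (chi_den cs t k)) in *.
  assert (Ht2 : 0 < 1 - t ^ 2) by nra.
  split; intros Hlt.
  - assert (p < q).
    { apply (Rmult_lt_compat_r q) in Hlt; [ | lra].
      unfold Rdiv in Hlt. rewrite Rmult_assoc, Rinv_l in Hlt; lra. }
    assert (0 < q ^ 2 - p ^ 2) by nra.
    assert (0 < 1 - (1 - cs ^ 2) * k ^ 2); [ | lra].
    apply (Rmult_lt_reg_l (1 - t ^ 2)); [exact Ht2 | ]. lra.
  - assert (0 < q ^ 2 - p ^ 2) by (rewrite H; apply Rmult_lt_0_compat; lra).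
    assert (p < q) by nra.
    apply (Rmult_lt_reg_r q); [lra | ].
    unfold Rdiv. rewrite Rmult_assoc, Rinv_l; lra.
Qed.

(** Q is invariant under its own flow: the form x^2 + 2 cs x y + y^2 at ([chi_num], [chi_den]) is
    its value at (t, 1) times the determinant 1 - (1 - cs^2) k^2 of I + k N. *)
Lemma quad_chi (cs t k : R) :
  (quad cs (chi cs t k) * (chi_den cs t k * chi_den cs t k))%C =
  RtoC ((1 - (1 - cs ^ 2) * k ^ 2) * (1 + 2 * cs * t + t ^ 2)).
Proof.
  replace (quad cs (chi cs t k) * (chi_den cs t k * chi_den cs t k))%C with
    (chi_den cs t k * chi_den cs t k + 2 * RtoC cs * chi_num cs t k * chi_den cs t k +
     chi_num cs t k * chi_num cs t k)%C.
  2: { unfold quad, chi. field. apply chi_den_neq_0. }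
  apply C_eq; simpl; ring.
Qed.

Lemma real_quad_pos (cs t : R) : -1 <= cs <= 1 -> -1 < t < 1 -> 0 < 1 + 2 * cs * t + t ^ 2.
Proof. intros Hc Ht. destruct (Rle_lt_dec 0 t); nra. Qed.

Lemma chi_surjective (cs : R) (u : C) : -1 <= cs <= 1 -> unit_disc u ->
  exists t k, -1 < t < 1 /\ (1 - cs ^ 2) * k ^ 2 < 1 /\ chi cs t k = u.
Proof.
  intros Hc Hu. pose proof (proj1 (unit_disc_sqr u) Hu) as Hu2.
  set (x := Re u) in *. set (y := Im u) in *.
  set (N := x ^ 2 + y ^ 2) in *.
  assert (HN : x ^ 2 <= N) by (unfold N; nra).
  assert (Hx : -1 < x < 1) by (split; nra).
  (* [t] must make [(u - t) / (1 + cs t + u (cs + t))] purely imaginary. *)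
  assert (Hroot : exists t, -1 < t < 1 /\
            (x + cs * N) - t * (1 - N) - t ^ 2 * (cs + x) = 0).
  (* At t = -1 and t = 1 the polynomial equals (1-N)(1-cs) and -(1-N)(1+cs). For cs = 1 or cs = -1
     one endpoint is itself a root, and the other root is written down explicitly. *)
  { destruct (Req_dec cs 1) as [-> | H1]; [ | destruct (Req_dec cs (-1)) as [-> | H2]].
    - exists ((x + N) / (1 + x)).
      split; [ | field; lra].
      assert (E : (x + N) / (1 + x) * (1 + x) = x + N) by (field; lra).
      split; apply (Rmult_lt_reg_r (1 + x)); nra.
    - exists ((x - N) / (1 - x)).
      split; [ | field; lra].
      assert (E : (x - N) / (1 - x) * (1 - x) = x - N) by (field; lra).
      split; apply (Rmult_lt_reg_r (1 - x)); nra.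
    - destruct (Ranalysis5.IVT_interv
        (fun t => - ((x + cs * N) - t * (1 - N) - t ^ 2 * (cs + x))) (-1) 1)
        as (t & Ht & E).
      + intros t Ht. apply derivable_continuous_pt.
        exists (- (0 - 1 * (1 - N) - (2 * t) * (cs + x))).
        apply is_derive_Reals. auto_derive; [exact I | ring].
      + lra.
      + nra.
      + nra.
      + exists t. split; [ | lra].
        split; [destruct (Req_dec t (-1)) as [-> | ]; [nra | lra]
               | destruct (Req_dec t 1) as [-> | ]; [nra | lra]]. }
  destruct Hroot as (t & Ht & E).
  set (n1 := x - t). set (d1 := 1 + cs * t + x * (cs + t)). set (d2 := y * (cs + t)).
  assert (Hperp : n1 * d1 + y * d2 = 0).
  { rewrite <- E. unfold n1, d1, d2, N. ring. }
  assert (Hden : 0 < d1 ^ 2 + d2 ^ 2).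
  { assert (Hct : 0 < 1 + cs * t) by (destruct (Rle_lt_dec 0 t); nra).
    assert (Hd1 : 0 < d1).
    { unfold d1. assert ((cs + t) ^ 2 <= (1 + cs * t) ^ 2).
      { assert (0 <= (1 - cs ^ 2) * (1 - t ^ 2)) by (apply Rmult_le_pos; nra). lra. }
      assert (- (1 + cs * t) <= cs + t <= 1 + cs * t) by (split; nra).
      destruct (Rle_lt_dec 0 x); nra. }
    nra. }
  (* The imaginary part of (u - t) / (d1 + i d2), a quotient whose real part vanishes by [Hperp]. *)
  set (k := (y * d1 - n1 * d2) / (d1 ^ 2 + d2 ^ 2)).
  assert (K1 : n1 = - (k * d2)).
  { unfold k. apply (Rmult_eq_reg_r (d1 ^ 2 + d2 ^ 2)); [ | lra].
    replace (- ((y * d1 - n1 * d2) / (d1 ^ 2 + d2 ^ 2) * d2) * (d1 ^ 2 + d2 ^ 2))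
      with (- (y * d1 - n1 * d2) * d2) by (field; lra).
    replace (n1 * (d1 ^ 2 + d2 ^ 2))
      with (d1 * (n1 * d1 + y * d2) - (y * d1 - n1 * d2) * d2) by ring.
    rewrite Hperp. ring. }
  assert (K2 : y = k * d1).
  { unfold k. apply (Rmult_eq_reg_r (d1 ^ 2 + d2 ^ 2)); [ | lra].
    replace ((y * d1 - n1 * d2) / (d1 ^ 2 + d2 ^ 2) * d1 * (d1 ^ 2 + d2 ^ 2))
      with ((y * d1 - n1 * d2) * d1) by (field; lra).
    replace (y * (d1 ^ 2 + d2 ^ 2))
      with (d2 * (n1 * d1 + y * d2) + (y * d1 - n1 * d2) * d1) by ring.
    rewrite Hperp. ring. }
  assert (Echi : chi cs t k = u).
  { unfold chi. replace (chi_num cs t k) with (u * chi_den cs t k)%C.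
    - field. apply chi_den_neq_0.
    - unfold n1, d1, d2 in K1, K2.
      apply C_eq; unfold chi_num, chi_den; simpl;
        change (fst u) with x; change (snd u) with y; clear -K1 K2; clearbody x y k; lra. }
  exists t, k. split; [exact Ht | ]. split; [ | exact Echi].
  apply (chi_in_disc cs t k Ht). now rewrite Echi.
Qed.

(** [chi] is a quotient of polynomials of degree at most one in each variable, so its remainder has
    a closed form with visible quadratic factors, and all denominators have modulus at least 1. *)
Lemma chi_expansion (cs t k : R) : exists K d : R, 0 <= K /\ 0 < d /\ forall t' k',
  Rmax (Rabs (t' - t)) (Rabs (k' - k)) < d ->
  Cmod (chi cs t' k' - chi cs t k -
        (RtoC (t' - t) * chi_dt cs t k + RtoC (k' - k) * chi_dk cs t k)) <=
  K * Rmax (Rabs (t' - t)) (Rabs (k' - k)) ^ 2.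
Proof.
  set (q := chi_den cs t k).
  set (c := (Ci * RtoC cs * q + Ci * chi_num cs t k)%C).
  set (A := Cmod (chi_dt cs t k) + Cmod (chi_dk cs t k)).
  set (B := Rabs k + Rabs (t + cs) + 1).
  assert (HA : 0 <= A)
    by (apply Rplus_le_le_0_compat; apply Cmod_ge_0).
  assert (HB : 0 <= B)
    by (assert (H1 := Rabs_pos k); assert (H2 := Rabs_pos (t + cs)); unfold B; lra).
  exists (A * B + Cmod c), 1.
  split; [ | split; [lra | ]].
  { assert (H := Cmod_ge_0 c). nra. }
  intros t' k' Hm. set (m := Rmax _ _) in *.
  set (q' := chi_den cs t' k').
  set (L := (RtoC (t' - t) * chi_dt cs t k + RtoC (k' - k) * chi_dk cs t k)%C).
  assert (Hq : q <> 0) by apply chi_den_neq_0.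
  assert (Hq' : q' <> 0) by apply chi_den_neq_0.
  assert (M1 : Rabs (t' - t) <= m) by apply Rmax_l.
  assert (M2 : Rabs (k' - k) <= m) by apply Rmax_r.
  assert (P1 := Rabs_pos (t' - t)). assert (P2 := Rabs_pos (k' - k)).
  assert (E : (chi cs t' k' - chi cs t k - L)%C =
              (L * (q - q') / q' + c * RtoC ((t' - t) * (k' - k)) / (q * q'))%C).
  { assert (EL : (L * (q * q))%C =
       (RtoC (t' - t) * RtoC (1 - (1 - cs ^ 2) * k ^ 2) +
        RtoC (k' - k) * (Ci * RtoC (1 + 2 * cs * t + t ^ 2)))%C).
    { unfold L, chi_dt, chi_dk. fold q. field. exact Hq. }
    assert (EN : (chi_num cs t' k' * q - chi_num cs t k * q')%C =
                 (L * (q * q) + c * RtoC ((t' - t) * (k' - k)))%C).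
    { rewrite EL. unfold c, q, q'. apply C_eq; simpl; ring. }
    unfold chi. fold q q'.
    replace (chi_num cs t' k' / q' - chi_num cs t k / q - L)%C
      with ((chi_num cs t' k' * q - chi_num cs t k * q') / (q * q') - L)%C
      by (field; auto).
    rewrite EN. field. auto. }
  rewrite E. eapply Rle_trans; [apply Cmod_triangle | ].
  assert (Q1 : 1 <= Cmod q) by apply chi_den_ge_1.
  assert (Q2 : 1 <= Cmod q') by apply chi_den_ge_1.
  rewrite !Cmod_div, !Cmod_mult, Cmod_R, Rabs_mult by (auto; now apply Cmult_neq_0).
  assert (HL : Cmod L <= A * m).
  { unfold L. eapply Rle_trans; [apply Cmod_triangle | ].
    rewrite !Cmod_mult, !Cmod_R. unfold A.
    assert (H1 := Cmod_ge_0 (chi_dt cs t k)). assert (H2 := Cmod_ge_0 (chi_dk cs t k)).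
    nra. }
  assert (HQ : Cmod (q - q') <= B * m).
  { replace (q - q')%C with (Ci * RtoC (k * (t' - t) + (t + cs) * (k' - k) +
                                          (t' - t) * (k' - k)))%C
      by (unfold q, q'; apply C_eq; simpl; ring).
    rewrite Cmod_mult, Cmod_Ci, Cmod_R, Rmult_1_l.
    eapply Rle_trans; [apply Rabs_triang | ].
    eapply Rle_trans; [apply Rplus_le_compat_r, Rabs_triang | ].
    rewrite !Rabs_mult. unfold B.
    assert (H1 := Rabs_pos k). assert (H2 := Rabs_pos (t + cs)). nra. }
  assert (Hdiv : forall x y, 0 <= x -> 1 <= y -> x / y <= x).
  { intros x y Hx Hy. apply (Rmult_le_reg_r y); [lra | ].
    unfold Rdiv. rewrite Rmult_assoc, Rinv_l by lra. nra. }
  assert (H0 := Cmod_ge_0 L). assert (H1 := Cmod_ge_0 (q - q')). assert (H2 := Cmod_ge_0 c).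
  assert (H3 : 0 <= Cmod c * (Rabs (t' - t) * Rabs (k' - k)))
    by (apply Rmult_le_pos; nra).
  rewrite Rmult_plus_distr_r.
  apply Rplus_le_compat.
  - eapply Rle_trans; [apply Hdiv; [nra | exact Q2] | ].
    replace (A * B * m ^ 2) with ((A * m) * (B * m)) by ring.
    apply Rmult_le_compat; lra.
  - eapply Rle_trans; [apply Hdiv; [exact H3 | nra] | ].
    apply Rmult_le_compat_l; [exact H2 | ]. nra.
Qed.

Lemma differentiable_comp_chi (part : C -> R) (F : C -> C) (l : C) (cs t k : R) :
  (forall c, Rabs (part c) <= Cmod c) ->
  (forall u v, part (u - v)%C = part u - part v) ->
  (forall u v, part (u + v)%C = part u + part v) ->
  (forall (x : R) u, part (RtoC x * u)%C = x * part u) ->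
  C_is_derive F (chi cs t k) l ->
  differentiable_pt_lim (fun t k => part (F (chi cs t k))) t k
    (part (l * chi_dt cs t k)%C) (part (l * chi_dk cs t k)%C).
Proof.
  intros Hpart Hminus Hplus Hscal HF eps.
  destruct (chi_expansion cs t k) as (K & d & HK & Hd & Hexp).
  set (L := fun t' k' => (RtoC (t' - t) * chi_dt cs t k + RtoC (k' - k) * chi_dk cs t k)%C).
  set (A := Cmod (chi_dt cs t k) + Cmod (chi_dk cs t k) + 1).
  assert (HA : 1 <= A).
  { assert (H1 := Cmod_ge_0 (chi_dt cs t k)). assert (H2 := Cmod_ge_0 (chi_dk cs t k)).
    unfold A. lra. }
  assert (Heps := cond_pos eps). assert (Hl := Cmod_ge_0 l).
  assert (He : 0 < eps / (2 * A)) by (apply Rdiv_lt_0_compat; lra).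
  destruct (proj1 (C_is_derive_eps _ _ _) HF (mkposreal _ He)) as [d1 Hd1].
  simpl in Hd1.
  assert (HKl : 0 < eps / (2 * (Cmod l * K + 1)))
    by (apply Rdiv_lt_0_compat; nra).
  assert (HK1 : 0 < / (K + 1)) by (apply Rinv_0_lt_compat; lra).
  assert (Hd1A : 0 < d1 / A) by (apply Rdiv_lt_0_compat; [apply cond_pos | lra]).
  (* In order: the expansion of [chi] applies; [chi] moves by less than [d1]; K m^2 is at most m;
     the error |l| K m^2 is at most eps/2 m. *)
  set (d' := Rmin (Rmin d (d1 / A)) (Rmin (/ (K + 1)) (eps / (2 * (Cmod l * K + 1))))).
  assert (Hd' : 0 < d') by (repeat apply Rmin_glb_lt; lra).
  exists (mkposreal _ Hd'). simpl. intros t' k' Ht' Hk'.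
  set (m := Rmax (Rabs (t' - t)) (Rabs (k' - k))).
  assert (Hm : m < d') by now apply Rmax_lub_lt.
  assert (Hm0 : 0 <= m) by (eapply Rle_trans; [apply Rabs_pos | apply Rmax_l]).
  assert (M1 : d' <= d) by (unfold d'; eapply Rle_trans; apply Rmin_l).
  assert (M2 : d' <= d1 / A)
    by (unfold d'; eapply Rle_trans; [apply Rmin_l | apply Rmin_r]).
  assert (M3 : d' <= / (K + 1))
    by (unfold d'; eapply Rle_trans; [apply Rmin_r | apply Rmin_l]).
  assert (M4 : d' <= eps / (2 * (Cmod l * K + 1)))
    by (unfold d'; eapply Rle_trans; [apply Rmin_r | apply Rmin_r]).
  specialize (Hexp t' k' ltac:(fold m; lra)). fold m in Hexp.
  set (D := (chi cs t' k' - chi cs t k)%C) in *.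
  change (Cmod (D - L t' k') <= K * m ^ 2) in Hexp.
  assert (HKm : (K + 1) * m <= 1).
  { apply (Rmult_le_reg_l (/ (K + 1))); [exact HK1 | ].
    rewrite <- Rmult_assoc, Rinv_l; lra. }
  assert (HL : Cmod (L t' k') <= (A - 1) * m).
  { unfold L. eapply Rle_trans; [apply Cmod_triangle | ].
    rewrite !Cmod_mult, !Cmod_R. unfold A.
    assert (H1 := Cmod_ge_0 (chi_dt cs t k)). assert (H2 := Cmod_ge_0 (chi_dk cs t k)).
    assert (Q1 : Rabs (t' - t) <= m) by apply Rmax_l.
    assert (Q2 : Rabs (k' - k) <= m) by apply Rmax_r. nra. }
  assert (HD : Cmod D <= A * m).
  { replace D with ((D - L t' k') + L t' k')%C by ring.
    eapply Rle_trans; [apply Cmod_triangle | ]. nra. }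
  assert (HDd : Cmod D < d1).
  { eapply Rle_lt_trans; [exact HD | ].
    apply (Rmult_lt_reg_r (/ A)); [apply Rinv_0_lt_compat; lra | ].
    replace (A * m * / A) with m by (field; lra). unfold Rdiv in M2. lra. }
  specialize (Hd1 _ HDd). fold D in Hd1.
  replace (part (F (chi cs t' k')) - part (F (chi cs t k)) -
           (part (l * chi_dt cs t k)%C * (t' - t) + part (l * chi_dk cs t k)%C * (k' - k)))
    with (part (F (chi cs t' k') - F (chi cs t k) - l * L t' k')%C).
  2: { rewrite !Hminus. unfold L.
       replace (l * (RtoC (t' - t) * chi_dt cs t k + RtoC (k' - k) * chi_dk cs t k))%C
         with (RtoC (t' - t) * (l * chi_dt cs t k) +
               RtoC (k' - k) * (l * chi_dk cs t k))%C by ring.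
       rewrite Hplus, !Hscal. ring. }
  eapply Rle_trans; [apply Hpart | ].
  replace (F (chi cs t' k') - F (chi cs t k) - l * L t' k')%C
    with ((F (chi cs t' k') - F (chi cs t k) - D * l) + l * (D - L t' k'))%C by ring.
  eapply Rle_trans; [apply Cmod_triangle | ]. rewrite Cmod_mult.
  assert (H1 : eps / (2 * A) * Cmod D <= eps / 2 * m).
  { replace (eps / 2 * m) with (eps / (2 * A) * (A * m)) by (field; lra).
    apply Rmult_le_compat_l; lra. }
  assert (H2 : Cmod l * Cmod (D - L t' k') <= eps / 2 * m).
  { apply Rle_trans with ((Cmod l * K + 1) * m * m).
    - assert (Cmod l * Cmod (D - L t' k') <= Cmod l * (K * m ^ 2))
        by (apply Rmult_le_compat_l; lra). nra.
    - apply Rmult_le_compat_r; [exact Hm0 | ].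
      replace (eps / 2) with ((Cmod l * K + 1) * (eps / (2 * (Cmod l * K + 1))))
        by (field; nra).
      apply Rmult_le_compat_l; nra. }
  fold m. lra.
Qed.

Lemma differentiable_Re_chi (F : C -> C) (l : C) (cs t k : R) :
  C_is_derive F (chi cs t k) l ->
  differentiable_pt_lim (fun t k => Re (F (chi cs t k))) t k
    (Re (l * chi_dt cs t k)) (Re (l * chi_dk cs t k)).
Proof.
  apply differentiable_comp_chi; try reflexivity; [apply re_le_Cmod | ].
  intros x u. unfold Re, Im. simpl. ring.
Qed.

Lemma differentiable_Im_chi (F : C -> C) (l : C) (cs t k : R) :
  C_is_derive F (chi cs t k) l ->
  differentiable_pt_lim (fun t k => Im (F (chi cs t k))) t k
    (Im (l * chi_dt cs t k)) (Im (l * chi_dk cs t k)).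
Proof.
  apply differentiable_comp_chi; try reflexivity; [apply im_le_Cmod | ].
  intros x u. unfold Re, Im. simpl. ring.
Qed.

(** The k-curves follow the field i Q with time element dk / (1 - (1 - cs^2) k^2), as k = tanh (s r)
    / r predicts. *)
Lemma chi_dk_quad (cs t k : R) : (1 - cs ^ 2) * k ^ 2 < 1 ->
  chi_dk cs t k = (Ci * quad cs (chi cs t k) / RtoC (1 - (1 - cs ^ 2) * k ^ 2))%C.
Proof.
  intros Hk. assert (Hq := chi_den_neq_0 cs t k).
  assert (Hs : RtoC (1 - (1 - cs ^ 2) * k ^ 2) <> 0)
    by (intros E; apply RtoC_inj in E; lra).
  replace (quad cs (chi cs t k)) with
    (quad cs (chi cs t k) * (chi_den cs t k * chi_den cs t k) /
     (chi_den cs t k * chi_den cs t k))%C by (field; auto).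
  rewrite quad_chi, RtoC_mult. unfold chi_dk. field. auto.
Qed.

(** This is the Jacobian of [chi]. The two partial derivatives are orthogonal: the product is i
    times a positive number. *)
Lemma chi_orientation (cs t k : R) :
  -1 <= cs <= 1 -> -1 < t < 1 -> (1 - cs ^ 2) * k ^ 2 < 1 ->
  0 < Im (Cconj (chi_dt cs t k) * chi_dk cs t k).
Proof.
  intros Hc Ht Hk.
  set (q2 := (chi_den cs t k * chi_den cs t k)%C).
  assert (Hq : q2 <> 0) by (apply Cmult_neq_0; apply chi_den_neq_0).
  assert (E : (Cconj (chi_dt cs t k) * chi_dk cs t k)%C =
    (Ci * RtoC ((1 - (1 - cs ^ 2) * k ^ 2) * (1 + 2 * cs * t + t ^ 2) / Cmod q2 ^ 2))%C).
  { unfold chi_dt, chi_dk. fold q2. rewrite Cdiv_conj by exact Hq.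
    assert (H : Cmod q2 <> 0) by (apply Cmod_gt_0 in Hq; lra).
    assert (Hc2 : Cconj q2 <> 0).
    { intros E. apply H. rewrite <- Cmod_conj, E. apply Cmod_0. }
    unfold Rdiv. rewrite RtoC_mult, RtoC_inv, Cmod2_conj by now apply pow_nonzero.
    rewrite RtoC_mult.
    replace (Cconj (RtoC (1 - (1 - cs ^ 2) * k ^ 2)))
      with (RtoC (1 - (1 - cs ^ 2) * k ^ 2)) by (apply C_eq; simpl; ring).
    field. auto. }
  rewrite E. set (x := _ / _). replace (Im (Ci * RtoC x)) with x by (simpl; ring).
  apply Rdiv_lt_0_compat.
  - apply Rmult_lt_0_compat; [lra | now apply real_quad_pos].
  - apply pow_lt. now apply Cmod_gt_0.
Qed.

(* The imaginary part of [u / (1 + 2 cs u + u^2)] at [u = chi t k]. *)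
Definition slit_height (cs t k : R) : R :=
  k * (1 - t ^ 2) / ((1 - (1 - cs ^ 2) * k ^ 2) * (1 + 2 * cs * t + t ^ 2)).

(** The derivative of u/Q is (1-u^2)/Q^2, so along i Q the value of u/Q moves by i (1-u^2)/Q. *)
Lemma slit_height_derivable (cs t k : R) :
  -1 <= cs <= 1 -> -1 < t < 1 -> (1 - cs ^ 2) * k ^ 2 < 1 ->
  derivable_pt_lim (slit_height cs t) k
    (Re ((1 - chi cs t k * chi cs t k) / quad cs (chi cs t k)) /
     (1 - (1 - cs ^ 2) * k ^ 2)).
Proof.
  intros Hc Ht Hk. assert (Hr := real_quad_pos cs t Hc Ht).
  set (s := 1 - (1 - cs ^ 2) * k ^ 2). set (r := 1 + 2 * cs * t + t ^ 2) in *.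
  assert (Hs : 0 < s) by (unfold s; lra).
  assert (Hu : unit_disc (chi cs t k)) by now apply chi_in_disc.
  assert (E : Re ((1 - chi cs t k * chi cs t k) / quad cs (chi cs t k)) =
              (1 - t ^ 2) * (1 + (1 - cs ^ 2) * k ^ 2) / (s * r)).
  { assert (Hq := chi_den_neq_0 cs t k).
    assert (Hqd := quad_neq_0 cs _ Hc Hu).
    assert (Hsr : RtoC (s * r) <> 0) by (intros E; apply RtoC_inj in E; nra).
    replace ((1 - chi cs t k * chi cs t k) / quad cs (chi cs t k))%C
      with (RtoC (/ (s * r)) * (chi_den cs t k * chi_den cs t k -
              chi_num cs t k * chi_num cs t k))%C.
    - simpl. unfold Rdiv. ring.
    - rewrite RtoC_inv by nra.
      unfold s, r in *. rewrite <- quad_chi in *.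
      assert (En : chi_num cs t k = (chi cs t k * chi_den cs t k)%C)
        by (unfold chi; field; exact Hq).
      rewrite En. field. auto. }
  rewrite E. apply is_derive_Reals. unfold slit_height.
  assert (H1 : s * r <> 0) by (apply Rgt_not_eq; nra).
  auto_derive.
  - replace (_ * _) with (s * r) by (unfold s, r; ring). exact H1.
  - replace ((1 + - ((1 - cs * (cs * 1)) * (k * (k * 1)))) *
             (1 + 2 * cs * t + t * (t * 1))) with (s * r) by (unfold s, r; ring).
    replace (1 + 2 * cs * t + t * (t * 1)) with r by (unfold r; ring).
    replace ((1 - cs ^ 2) * k ^ 2) with (1 - s) by (unfold s; ring).
    replace (1 + (1 - s)) with (s + 2 * (1 - cs ^ 2) * k ^ 2) by (unfold s; ring).
    field. lra.
Qed.

(** * Shears of the disc *)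

Lemma slit_height_unbounded (cs t L : R) :
  -1 <= cs <= 1 -> -1 < t < 1 ->
  exists k, 0 <= k /\ (1 - cs ^ 2) * k ^ 2 < 1 /\ L <= slit_height cs t k.
Proof.
  intros Hc Ht. assert (Hr := real_quad_pos cs t Hc Ht).
  set (r := 1 + 2 * cs * t + t ^ 2) in *.
  assert (Ht2 : 0 < 1 - t ^ 2) by nra.
  assert (Hs : 0 <= 1 - cs ^ 2) by nra. set (s := 1 - cs ^ 2) in *.
  (* With k = l/w and w^2 = 1 + s l^2 one has 1 - s k^2 = 1/w^2, so k is admissible and the height
     is |L| w >= L, also when s = 0. *)
  set (l := Rabs L * r / (1 - t ^ 2)).
  assert (Hl : 0 <= l).
  { apply Rdiv_le_0_compat; [ | exact Ht2].
    apply Rmult_le_pos; [apply Rabs_pos | lra]. }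
  set (w := sqrt (1 + s * l ^ 2)).
  assert (Hsl : 0 <= s * l ^ 2) by (apply Rmult_le_pos; nra).
  assert (Hw2 : w * w = 1 + s * l ^ 2) by (apply sqrt_sqrt; lra).
  assert (Hw : 1 <= w) by (rewrite <- sqrt_1; apply sqrt_le_1_alt; lra).
  assert (Hk : 1 - s * (l / w) ^ 2 = / (w * w)).
  { apply (Rmult_eq_reg_r (w * w)); [ | nra].
    rewrite Rinv_l by nra.
    replace ((1 - s * (l / w) ^ 2) * (w * w)) with (w * w - s * l ^ 2) by (field; lra).
    rewrite Hw2. ring. }
  assert (Hwi : 0 < / (w * w)) by (apply Rinv_0_lt_compat; nra).
  exists (l / w). split; [ | split].
  - apply Rdiv_le_0_compat; lra.
  - lra.
  - unfold slit_height. fold s r. rewrite Hk.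
    replace (l / w * (1 - t ^ 2) / (/ (w * w) * r)) with (Rabs L * w)
      by (unfold l; field; repeat split; lra).
    assert (H1 := Rle_abs L). assert (H2 := Rabs_pos L). nra.
Qed.

Lemma slit_height_opp (cs t k : R) : slit_height cs t (- k) = - slit_height cs t k.
Proof.
  unfold slit_height. replace ((- k) ^ 2) with (k ^ 2) by ring.
  unfold Rdiv. ring.
Qed.

Section Shear_of_disc.

Variables (cs a d : R) (A B A' B' H : C -> C).
Hypothesis Hcs : -1 <= cs <= 1.
Hypothesis a_pos : 0 < a.
Hypothesis d_nonneg : 0 <= d.
Hypothesis A_derive : forall u, unit_disc u -> C_is_derive A u (A' u).
Hypothesis B_derive : forall u, unit_disc u -> C_is_derive B u (B' u).
Hypothesis dilatation : forall u, unit_disc u -> Cmod (B' u) < Cmod (A' u).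
Hypothesis H_pos : forall u, unit_disc u -> 0 < Re (H u).
Hypothesis shear_derive : forall u, unit_disc u ->
  ((A' u - B' u) * quad cs u)%C =
  (RtoC a * ((1 - u * u) / quad cs u) + RtoC d * H u)%C.

Let W (u : C) : C := (A u + Cconj (B u))%C.
Let V (t k : R) : R := Im (A (chi cs t k) - B (chi cs t k)).
Let X (t k : R) : R := Re (A (chi cs t k) + B (chi cs t k)).
Let J (k : R) : Prop := (1 - cs ^ 2) * k ^ 2 < 1.

Let Vt (t k : R) := Im ((A' (chi cs t k) - B' (chi cs t k)) * chi_dt cs t k).
Let Vk (t k : R) := Im ((A' (chi cs t k) - B' (chi cs t k)) * chi_dk cs t k).
Let Xt (t k : R) := Re ((A' (chi cs t k) + B' (chi cs t k)) * chi_dt cs t k).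
Let Xk (t k : R) := Re ((A' (chi cs t k) + B' (chi cs t k)) * chi_dk cs t k).

Let W_chi (t k : R) : W (chi cs t k) = (X t k, V t k).
Proof. unfold W, X, V. apply C_eq; unfold Re, Im; simpl; ring. Qed.

Let in_disc (t k : R) : -1 < t < 1 -> J k -> unit_disc (chi cs t k).
Proof. intros Ht Hk. now apply chi_in_disc. Qed.

Let J_convex (x y z : R) : J x -> J z -> x <= y <= z -> J y.
Proof.
  unfold J. intros Hx Hz Hy.
  assert (Hs : 0 <= 1 - cs ^ 2) by nra.
  destruct (Rle_lt_dec 0 y); [assert (y ^ 2 <= z ^ 2) by nra | assert (y ^ 2 <= x ^ 2) by nra];
    nra.
Qed.

Let J_open (x : R) : J x -> exists e, 0 < e /\ forall y, Rabs (y - x) < e -> J y.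
Proof.
  intros Hx.
  assert (Hcont : continuity_pt (fun y => (1 - cs ^ 2) * y ^ 2) x).
  { apply derivable_continuous_pt. exists ((1 - cs ^ 2) * (2 * x)).
    apply is_derive_Reals. auto_derive; [exact I | ring]. }
  destruct (Hcont (1 - (1 - cs ^ 2) * x ^ 2)) as (e & He & Hd).
  { unfold J in Hx. lra. }
  exists e. split; [exact He | ]. intros y Hy. unfold J.
  destruct (Req_dec x y) as [<- | Hxy]; [exact Hx | ].
  assert (Hb := Hd y (conj (conj I Hxy) Hy)). simpl in Hb. unfold R_dist in Hb.
  apply Rabs_def2 in Hb. simpl. lra.
Qed.

Let V_diff (t k : R) : -1 < t < 1 -> J k ->
  differentiable_pt_lim V t k (Vt t k) (Vk t k).
Proof.
  intros Ht Hk. assert (Hu := in_disc t k Ht Hk).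
  apply (differentiable_Im_chi (fun u => A u - B u)%C).
  apply (is_derive_minus (K := C_AbsRing) (V := C_NormedModule) A B); auto.
Qed.

Let X_diff (t k : R) : -1 < t < 1 -> J k ->
  differentiable_pt_lim X t k (Xt t k) (Xk t k).
Proof.
  intros Ht Hk. assert (Hu := in_disc t k Ht Hk).
  apply (differentiable_Re_chi (fun u => A u + B u)%C).
  apply (is_derive_plus (K := C_AbsRing) (V := C_NormedModule) A B); auto.
Qed.

Let Vk_value (t k : R) : -1 < t < 1 -> J k ->
  Vk t k = (a * Re ((1 - chi cs t k * chi cs t k) / quad cs (chi cs t k)) +
            d * Re (H (chi cs t k))) / (1 - (1 - cs ^ 2) * k ^ 2).
Proof.
  intros Ht Hk. unfold Vk. rewrite chi_dk_quad by exact Hk.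
  set (u := chi cs t k). set (s := 1 - (1 - cs ^ 2) * k ^ 2).
  assert (Hs : s <> 0) by (unfold s, J in *; lra).
  assert (Hs' : RtoC s <> 0) by (intros E; apply RtoC_inj in E; auto).
  assert (E := shear_derive u (in_disc t k Ht Hk)).
  replace ((A' u - B' u) * (Ci * quad cs u / RtoC s))%C
    with (RtoC (/ s) * (Ci * ((A' u - B' u) * quad cs u)))%C
    by (rewrite RtoC_inv by exact Hs; field; auto).
  rewrite E. set (P := ((1 - u * u) / quad cs u)%C).
  clearbody P s. generalize (H u). intros h.
  unfold Re, Im. simpl. field. exact Hs.
Qed.

Let Vk_pos (t k : R) : -1 < t < 1 -> J k -> 0 < Vk t k.
Proof.
  intros Ht Hk. rewrite Vk_value by auto.
  assert (Hu := in_disc t k Ht Hk).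
  assert (H1 := Re_quad_quotient_pos cs _ Hcs Hu). assert (H2 := H_pos _ Hu).
  unfold J in Hk. apply Rdiv_lt_0_compat; [nra | lra].
Qed.

Let jacobian_pos (t k : R) : -1 < t < 1 -> J k ->
  0 < Xt t k * Vk t k - Xk t k * Vt t k.
Proof.
  intros Ht Hk. assert (Hu := in_disc t k Ht Hk).
  assert (Ho := chi_orientation cs t k Hcs Ht Hk).
  assert (Hd := dilatation _ Hu). unfold Xt, Xk, Vt, Vk.
  set (alpha := A' (chi cs t k)) in *. set (beta := B' (chi cs t k)) in *.
  set (ct := chi_dt cs t k) in *. set (ck := chi_dk cs t k) in *.
  (* The Jacobian of W after [chi] is the product of the two Jacobians. *)
  replace (_ - _) with ((Cmod alpha ^ 2 - Cmod beta ^ 2) * Im (Cconj ct * ck)).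
  2: { rewrite !Cmod2_alt. unfold Re, Im. simpl. ring. }
  apply Rmult_lt_0_compat; [ | exact Ho].
  assert (H0 := Cmod_ge_0 beta). nra.
Qed.

(** The derivative of V exceeds a times that of [slit_height] by a nonnegative multiple of d Re
    H. *)
Let V_growth (t k1 k2 : R) : -1 < t < 1 -> J k1 -> J k2 -> k1 <= k2 ->
  a * (slit_height cs t k2 - slit_height cs t k1) <= V t k2 - V t k1.
Proof.
  intros Ht J1 J2 Hle. destruct Hle as [Hlt | ->]; [ | lra].
  set (M' := fun k => Re ((1 - chi cs t k * chi cs t k) / quad cs (chi cs t k)) /
                      (1 - (1 - cs ^ 2) * k ^ 2)).
  destruct (MVT_cor2 (fun k => V t k - a * slit_height cs t k)
              (fun k => Vk t k - a * M' k) k1 k2 Hlt) as (k & E & Hk).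
  - intros k Hk. assert (Jk : J k) by now apply (J_convex k1 k k2).
    apply (derivable_pt_lim_minus (V t) (fun k => a * slit_height cs t k)).
    + apply (differentiable_pt_lim_slice _ _ _ (Vt t k)). auto.
    + apply (derivable_pt_lim_scal (slit_height cs t)).
      now apply slit_height_derivable.
  - assert (Jk : J k) by (apply (J_convex k1 k k2); auto; lra).
    assert (Hpos : 0 <= Vk t k - a * M' k).
    { rewrite Vk_value by auto. unfold M'.
      assert (H2 := H_pos _ (in_disc t k Ht Jk)).
      assert (Hs : 0 < 1 - (1 - cs ^ 2) * k ^ 2) by (unfold J in Jk; lra).
      match goal with |- 0 <= ?e => replace e with
        (d * Re (H (chi cs t k)) / (1 - (1 - cs ^ 2) * k ^ 2)) by (field; lra) end.
      apply Rdiv_le_0_compat; [nra | exact Hs]. }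
    nra.
Qed.

Let J_0 : J 0.
Proof. unfold J. lra. Qed.

Let V_high (t c : R) : -1 < t < 1 -> exists k, J k /\ c < V t k.
Proof.
  intros Ht.
  destruct (slit_height_unbounded cs t ((Rabs (c - V t 0) + 1) / a) Hcs Ht)
    as (k & Hk & Jk & HL).
  exists k. split; [exact Jk | ].
  assert (G := V_growth t 0 k Ht J_0 Jk Hk).
  replace (slit_height cs t 0) with 0 in G by (unfold slit_height, Rdiv; ring).
  apply (Rmult_le_compat_l a) in HL; [ | lra].
  replace (a * ((Rabs (c - V t 0) + 1) / a)) with (Rabs (c - V t 0) + 1) in HL
    by (field; lra).
  assert (Hb := Rle_abs (c - V t 0)). lra.
Qed.

Let V_low (t c : R) : -1 < t < 1 -> exists k, J k /\ V t k < c.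
Proof.
  intros Ht.
  destruct (slit_height_unbounded cs t ((Rabs (V t 0 - c) + 1) / a) Hcs Ht)
    as (k & Hk & Jk & HL).
  assert (Jk' : J (- k)) by (unfold J in *; replace ((- k) ^ 2) with (k ^ 2) by ring; auto).
  exists (- k). split; [exact Jk' | ].
  assert (G := V_growth t (- k) 0 Ht Jk' J_0 ltac:(lra)). rewrite slit_height_opp in G.
  replace (slit_height cs t 0) with 0 in G by (unfold slit_height, Rdiv; ring).
  apply (Rmult_le_compat_l a) in HL; [ | lra].
  replace (a * ((Rabs (V t 0 - c) + 1) / a)) with (Rabs (V t 0 - c) + 1) in HL
    by (field; lra).
  assert (Hb := Rle_abs (V t 0 - c)). lra.
Qed.

Let W_param (u : C) : unit_disc u ->
  exists t k, -1 < t < 1 /\ J k /\ chi cs t k = u /\ W u = (X t k, V t k).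
Proof.
  intros Hu. destruct (chi_surjective cs u Hcs Hu) as (t & k & Ht & Hk & E).
  exists t, k. repeat split; try tauto. now rewrite <- W_chi, E.
Qed.

Lemma disc_shear_univalent (u1 u2 : C) :
  unit_disc u1 -> unit_disc u2 -> W u1 = W u2 -> u1 = u2.
Proof.
  intros Hu1 Hu2 E.
  destruct (W_param u1 Hu1) as (t1 & k1 & Ht1 & Jk1 & <- & E1).
  destruct (W_param u2 Hu2) as (t2 & k2 & Ht2 & Jk2 & <- & E2).
  rewrite E1, E2 in E. injection E as EX EV.
  destruct (shear_injective V X Vt Vk Xt Xk (-1) 1 J J_convex J_open V_diff X_diff
              Vk_pos jacobian_pos V_low V_high t1 k1 t2 k2) as [-> ->]; auto.
Qed.

Lemma disc_shear_open (u : C) : unit_disc u ->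
  exists e : posreal, forall w, Cmod (w - W u) < e -> exists u', unit_disc u' /\ W u' = w.
Proof.
  intros Hu. destruct (W_param u Hu) as (t & k & Ht & Jk & Eu & E).
  destruct (shear_open V X Vt Vk Xt Xk (-1) 1 J J_convex J_open V_diff X_diff
              Vk_pos jacobian_pos V_low V_high t k Ht Jk) as (e & He & Ho).
  exists (mkposreal e He). simpl. intros w Hw.
  destruct (Ho (Re w) (Im w)) as (t' & k' & Ht' & Jk' & EX & EV).
  - eapply Rle_lt_trans; [ | exact Hw]. rewrite E. exact (re_le_Cmod (w - (X t k, V t k))).
  - eapply Rle_lt_trans; [ | exact Hw]. rewrite E. exact (im_le_Cmod (w - (X t k, V t k))).
  - exists (chi cs t' k'). split; [auto | ]. rewrite W_chi, EX, EV.
    symmetry. apply surjective_pairing.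
Qed.

(** Both points lie on one level curve of V; the path is X along that curve, with t running affinely
    from [t1] to [t2]. Since these are interior to (-1, 1), it extends slightly beyond both ends, as
    [path_connected] requires. *)
Lemma disc_shear_horizontal_path (u1 u2 : C) :
  unit_disc u1 -> unit_disc u2 -> Im (W u1) = Im (W u2) ->
  exists x : R -> R, x 0 = Re (W u1) /\ x 1 = Re (W u2) /\
    forall s, 0 <= s <= 1 ->
      (exists e : posreal, forall s', Rabs (s' - s) < e ->
         exists u, unit_disc u /\ W u = (x s', Im (W u1))) /\
      continuity_pt x s.
Proof.
  intros Hu1 Hu2 E.
  destruct (W_param u1 Hu1) as (t1 & k1 & Ht1 & Jk1 & <- & E1).
  destruct (W_param u2 Hu2) as (t2 & k2 & Ht2 & Jk2 & <- & E2).
  rewrite E1, E2 in *. simpl in E. simpl Im. simpl Re.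
  assert (L1 := level_unique V Vt Vk (-1) 1 J J_convex V_diff Vk_pos
              V_low V_high t1 k1 Ht1 Jk1).
  assert (L2 := level_unique V Vt Vk (-1) 1 J J_convex V_diff Vk_pos
              V_low V_high t2 k2 Ht2 Jk2).
  rewrite <- E in L2. set (c := V t1 k1) in *.
  set (tau := fun s => t1 + s * (t2 - t1)).
  exists (fun s => along V X J c (tau s)).
  split; [ | split].
  - unfold tau, along. rewrite Rmult_0_l, Rplus_0_r, L1. reflexivity.
  - unfold tau, along. replace (t1 + 1 * (t2 - t1)) with t2 by ring. now rewrite L2.
  - intros s Hs.
    assert (Htau : -1 < tau s < 1).
    { unfold tau. destruct (Rle_lt_dec s (1 / 2)); split; nra. }
    assert (Hcont : continuity_pt tau s).
    { apply derivable_continuous_pt. exists (t2 - t1). apply is_derive_Reals.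
      unfold tau. auto_derive; [exact I | ring]. }
    split.
    + assert (Hm : 0 < Rmin (tau s + 1) (1 - tau s)) by (apply Rmin_glb_lt; lra).
      destruct (proj1 (continuity_pt_locally tau s) Hcont (mkposreal _ Hm)) as [e He].
      exists e. intros s' Hs'. specialize (He s' Hs'). simpl in He.
      assert (M1 := Rmin_l (tau s + 1) (1 - tau s)).
      assert (M2 := Rmin_r (tau s + 1) (1 - tau s)).
      apply Rabs_def2 in He. assert (Ht' : -1 < tau s' < 1) by lra.
      destruct (level_spec V Vt Vk (-1) 1 J J_convex V_diff Vk_pos
                  V_low V_high c (tau s') Ht') as [Jl El].
      exists (chi cs (tau s') (level V J c (tau s'))). split; [auto | ].
      rewrite W_chi, El. reflexivity.
    + apply (continuity_pt_comp tau (along V X J c)); [exact Hcont | ].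
      apply (along_continuous V X Vt Vk Xt Xk (-1) 1 J J_convex J_open V_diff X_diff
                  Vk_pos jacobian_pos V_low V_high c (tau s) Htau).
Qed.

End Shear_of_disc.

(** * Rotated images and derivatives of the convolution *)

Section Rotated_image.

Variables (A B A' B' : C -> C) (beta kappa : R).

Let W (u : C) : C := (A u + Cconj (B u))%C.
Let E (w : C) : Prop :=
  exists u, unit_disc u /\ w = (RtoC kappa * cis (- beta) * W u)%C.

Hypothesis kappa_neq_0 : kappa <> 0.
Hypothesis A_derive : forall u, unit_disc u -> C_is_derive A u (A' u).
Hypothesis B_derive : forall u, unit_disc u -> C_is_derive B u (B' u).
Hypothesis W_open : forall u, unit_disc u ->
  exists e : posreal, forall w, Cmod (w - W u) < e -> exists u', unit_disc u' /\ W u' = w.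
Hypothesis W_path : forall u1 u2,
  unit_disc u1 -> unit_disc u2 -> Im (W u1) = Im (W u2) ->
  exists x : R -> R, x 0 = Re (W u1) /\ x 1 = Re (W u2) /\
    forall s, 0 <= s <= 1 ->
      (exists e : posreal, forall s', Rabs (s' - s) < e ->
         exists u, unit_disc u /\ W u = (x s', Im (W u1))) /\
      continuity_pt x s.

Lemma Cmod_cis (x : R) : Cmod (cis x) = 1.
Proof.
  unfold cis, Cmod. simpl fst. simpl snd.
  replace (cos x ^ 2 + sin x ^ 2) with 1; [apply sqrt_1 | ].
  assert (H := sin2_cos2 x). unfold Rsqr in H. lra.
Qed.

Lemma cis_neq_0 (x : R) : cis x <> 0.
Proof. intros H. assert (H1 := Cmod_cis x). rewrite H, Cmod_0 in H1. lra. Qed.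

Let Lam : C := (RtoC kappa * cis (- beta))%C.

Let Lam_mod : Cmod Lam = Rabs kappa.
Proof. unfold Lam. rewrite Cmod_mult, Cmod_cis, Cmod_R. ring. Qed.

Let kappa_pos : 0 < Rabs kappa.
Proof. now apply Rabs_pos_lt. Qed.

Let Lam_neq_0 : Lam <> 0.
Proof. apply Cmod_gt_0. rewrite Lam_mod. exact kappa_pos. Qed.

Let W_continuous (u : C) : unit_disc u ->
  forall eps : posreal, exists d : posreal, forall w,
    Cmod (w - u) < d -> Cmod (W w - W u) < eps.
Proof.
  intros Hu eps.
  destruct (C_is_derive_continuous _ _ _ (A_derive u Hu) (pos_div_2 eps)) as [d1 H1].
  destruct (C_is_derive_continuous _ _ _ (B_derive u Hu) (pos_div_2 eps)) as [d2 H2].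
  assert (Hm : 0 < Rmin d1 d2) by (apply Rmin_glb_lt; apply cond_pos).
  exists (mkposreal _ Hm). simpl. intros w Hw.
  specialize (H1 w (Rlt_le_trans _ _ _ Hw (Rmin_l _ _))).
  specialize (H2 w (Rlt_le_trans _ _ _ Hw (Rmin_r _ _))). simpl in H1, H2.
  replace (W w - W u)%C with ((A w - A u) + Cconj (B w - B u))%C.
  - eapply Rle_lt_trans; [apply Cmod_triangle | ]. rewrite Cmod_conj. lra.
  - unfold W. rewrite Cminus_conj. ring.
Qed.

Let E_open : open E.
Proof.
  apply open_Cmod. intros z (u & Hu & ->). fold Lam.
  destruct (W_open u Hu) as [e He].
  assert (Hp : 0 < e * Rabs kappa)
    by (apply Rmult_lt_0_compat; [apply cond_pos | exact kappa_pos]).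
  exists (mkposreal _ Hp). simpl. intros w Hw.
  destruct (He (w / Lam)%C) as (u' & Hu' & E').
  - replace (w / Lam - W u)%C with ((w - Lam * W u) / Lam)%C by (field; exact Lam_neq_0).
    rewrite Cmod_div, Lam_mod by exact Lam_neq_0.
    apply (Rmult_lt_reg_r (Rabs kappa)); [exact kappa_pos | ].
    unfold Rdiv. rewrite Rmult_assoc, Rinv_l; lra.
  - exists u'. split; [exact Hu' | ]. fold Lam. rewrite E'. field. exact Lam_neq_0.
Qed.

Let E_connected : connected E.
Proof.
  apply path_connected. intros z1 z2 (u1 & Hu1 & ->) (u2 & Hu2 & ->). fold Lam.
  set (g := fun s : R => (u1 + RtoC s * (u2 - u1))%C).
  exists (fun s => (Lam * W (g s))%C). split; [ | split].
  - unfold g. do 2 f_equal. ring.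
  - unfold g. do 2 f_equal. ring.
  - intros s Hs. assert (Hg : unit_disc (g s)) by now apply unit_disc_convex.
    assert (Hlip : forall s', Cmod (g s' - g s) <= Rabs (s' - s) * Cmod (u2 - u1)).
    { intros s'. right. rewrite <- Cmod_R, <- Cmod_mult. f_equal.
      unfold g. rewrite RtoC_minus. ring. }
    set (l := Cmod (u2 - u1)) in *.
    assert (Hl : 0 <= l) by apply Cmod_ge_0.
    assert (Hnear : forall e, 0 < e -> exists d : posreal, forall s',
              Rabs (s' - s) < d -> Cmod (g s' - g s) < e).
    { intros e He. assert (Hd : 0 < e / (l + 1)) by (apply Rdiv_lt_0_compat; lra).
      exists (mkposreal _ Hd). simpl. intros s' Hs'.
      apply (Rmult_lt_compat_r (l + 1)) in Hs'; [ | lra].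
      unfold Rdiv in Hs'. rewrite Rmult_assoc, Rinv_l in Hs' by lra.
      eapply Rle_lt_trans; [apply Hlip | ]. assert (H := Rabs_pos (s' - s)). lra. }
    split.
    + unfold unit_disc in Hg. destruct (Hnear (1 - Cmod (g s)) ltac:(lra)) as [d Hd].
      exists d. intros s' Hs'. exists (g s'). split; [ | reflexivity].
      unfold unit_disc. replace (g s') with ((g s' - g s) + g s)%C by ring.
      specialize (Hd s' Hs'). eapply Rle_lt_trans; [apply Cmod_triangle | lra].
    + intros eps.
      assert (Hp : 0 < eps / Rabs kappa)
        by (apply Rdiv_lt_0_compat; [apply cond_pos | exact kappa_pos]).
      destruct (W_continuous _ Hg (mkposreal _ Hp)) as [d Hd]. simpl in Hd.
      destruct (Hnear d (cond_pos d)) as [d' Hd'].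
      exists d'. intros s' Hs'. specialize (Hd _ (Hd' s' Hs')).
      replace (Lam * W (g s') - Lam * W (g s))%C
        with (Lam * (W (g s') - W (g s)))%C by ring.
      rewrite Cmod_mult, Lam_mod.
      apply (Rmult_lt_compat_l (Rabs kappa)) in Hd; [ | exact kappa_pos].
      replace (Rabs kappa * (eps / Rabs kappa)) with (eps : R) in Hd
        by (field; lra). exact Hd.
Qed.

(** Multiplication by kappa e^(-i beta) takes horizontal lines to lines of direction -beta, so a
    slice of the image is a horizontal slice of W. *)
Lemma rotated_image_convex : convex_in_direction (- beta) E.
Proof.
  split.
  { split; [ | split; [exact E_open | exact E_connected]].
    eexists. exists 0. split; [apply unit_disc_0 | reflexivity]. }
  (* An empty slice is covered too, being vacuously connected. *)
  intros p. cbv zeta. right. apply path_connected.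
  intros z1 z2 [(u1 & Hu1 & ->) [t1 L1]] [(u2 & Hu2 & ->) [t2 L2]].
  fold Lam. fold Lam in L1, L2.
  assert (Hcis := cis_neq_0 (- beta)).
  assert (HIm : Im (W u1) = Im (W u2)).
  { assert (D : (RtoC kappa * (W u1 - W u2))%C = RtoC (t1 - t2)).
    { replace (RtoC kappa * (W u1 - W u2))%C
        with ((Lam * W u1 - Lam * W u2) / cis (- beta))%C
        by (unfold Lam; field; exact Hcis).
      rewrite L1, L2, RtoC_minus. field. exact Hcis. }
    assert (Hs : forall c, Im (RtoC kappa * c) = kappa * Im c)
      by (intros c; unfold Im; simpl; ring).
    apply (f_equal Im) in D. rewrite Hs in D.
    apply Rmult_integral in D. destruct D as [D | D]; [tauto | ].
    change (Im (W u1) - Im (W u2) = 0) in D. lra. }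
  destruct (W_path u1 u2 Hu1 Hu2 HIm) as (x & X0 & X1 & Hx).
  assert (Hline : forall v, (Lam * (v, Im (W u1)))%C =
            (p + RtoC (t1 + kappa * (v - Re (W u1))) * cis (- beta))%C).
  { intros v.
    replace (Lam * (v, Im (W u1)))%C
      with (Lam * W u1 + RtoC (kappa * (v - Re (W u1))) * cis (- beta))%C.
    - rewrite L1, (RtoC_plus t1). ring.
    - unfold Lam. rewrite RtoC_mult.
      replace (v, Im (W u1)) with (W u1 + RtoC (v - Re (W u1)))%C; [ring | ].
      apply C_eq; unfold Re, Im; simpl; ring. }
  exists (fun s => (Lam * (x s, Im (W u1)))%C). split; [ | split].
  - cbv beta. apply f_equal. rewrite X0. symmetry. apply surjective_pairing.
  - cbv beta. apply f_equal. rewrite X1, HIm. symmetry. apply surjective_pairing.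
  - intros s Hs. destruct (Hx s Hs) as [[e He] Hcont]. split.
    + exists e. intros s' Hs'. destruct (He s' Hs') as (u & Hu & Eu). split.
      * exists u. split; [exact Hu | ]. fold Lam. now rewrite Eu.
      * eexists. apply Hline.
    + intros eps.
      assert (Hp : 0 < eps / Rabs kappa)
        by (apply Rdiv_lt_0_compat; [apply cond_pos | exact kappa_pos]).
      destruct (proj1 (continuity_pt_locally x s) Hcont (mkposreal _ Hp)) as [d Hd].
      exists d. intros s' Hs'. specialize (Hd s' Hs'). simpl in Hd.
      replace (Lam * (x s', Im (W u1)) - Lam * (x s, Im (W u1)))%C
        with (Lam * RtoC (x s' - x s))%C
        by (rewrite RtoC_minus; apply C_eq; unfold Re, Im; simpl; ring).
      rewrite Cmod_mult, Lam_mod, Cmod_R.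
      apply (Rmult_lt_compat_l (Rabs kappa)) in Hd; [ | exact kappa_pos].
      replace (Rabs kappa * (eps / Rabs kappa)) with (eps : R) in Hd
        by (field; lra). exact Hd.
Qed.

End Rotated_image.

Lemma convex_in_direction_ext (psi : R) (E F : C -> Prop) :
  (forall w, E w <-> F w) -> convex_in_direction psi E -> convex_in_direction psi F.
Proof.
  intros H. replace F with E; [auto | ].
  apply functional_extensionality. intros w.
  apply propositional_extensionality. apply H.
Qed.

(* [C] carries two normed module structures over itself, with the same norm. *)
Lemma C_is_derive_AbsRing (f : C -> C) (z l : C) :
  @is_derive C_AbsRing (AbsRing_NormedModule C_AbsRing) f z l <-> C_is_derive f z l.
Proof.
  split; intros [_ H]; (split; [apply is_linear_scal_l | exact H]).
Qed.

Lemma C_is_derive_mult (f g : C -> C) (z df dg : C) :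
  C_is_derive f z df -> C_is_derive g z dg ->
  C_is_derive (fun w => f w * g w)%C z (df * g z + f z * dg)%C.
Proof.
  rewrite <- !C_is_derive_AbsRing. intros Hf Hg.
  exact (is_derive_mult (K := C_AbsRing) f g z df dg Hf Hg Cmult_comm).
Qed.

Lemma C_is_derive_id (z : C) : C_is_derive (fun w => w) z (RtoC 1).
Proof. apply C_is_derive_AbsRing. exact (is_derive_id (K := C_AbsRing) z). Qed.

Lemma C_is_derive_const (a z : C) : C_is_derive (fun _ => a) z (RtoC 0).
Proof. exact (is_derive_const (K := C_AbsRing) (V := C_NormedModule) a z). Qed.

Lemma C_is_derive_plus (f g : C -> C) (z df dg : C) :
  C_is_derive f z df -> C_is_derive g z dg ->
  C_is_derive (fun w => f w + g w)%C z (df + dg)%C.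
Proof. exact (is_derive_plus (K := C_AbsRing) (V := C_NormedModule) f g z df dg). Qed.

Lemma C_is_derive_minus (f g : C -> C) (z df dg : C) :
  C_is_derive f z df -> C_is_derive g z dg ->
  C_is_derive (fun w => f w - g w)%C z (df - dg)%C.
Proof. exact (is_derive_minus (K := C_AbsRing) (V := C_NormedModule) f g z df dg). Qed.

Lemma C_is_derive_pow (n : nat) (z : C) :
  C_is_derive (fun w => w ^ n)%C z (RtoC (INR n) * z ^ pred n)%C.
Proof.
  induction n as [ | n IH].
  - simpl. rewrite Cmult_0_l. apply C_is_derive_const.
  - replace (RtoC (INR (S n)) * z ^ pred (S n))%C
      with (1 * z ^ n + z * (RtoC (INR n) * z ^ pred n))%C.
    + exact (C_is_derive_mult (fun w => w) (fun w => w ^ n)%C z _ _ (C_is_derive_id z) IH).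
    + rewrite S_INR, RtoC_plus. simpl pred.
      destruct n as [ | n]; [simpl; ring | ]. simpl pred. rewrite !Cpow_S. ring.
Qed.

Lemma C_is_derive_eq (f : C -> C) (z l l' : C) :
  C_is_derive f z l -> C_is_derive f z l' -> l = l'.
Proof.
  intros H H'. rewrite <- (is_C_derive_unique _ _ _ H). now apply is_C_derive_unique.
Qed.

Lemma C_derive_shear (p q f : C -> C) (lam z : C) :
  analytic p -> analytic q -> analytic f ->
  (forall w, unit_disc w -> p w - lam * q w = f w)%C -> unit_disc z ->
  (C_derive p z - lam * C_derive q z)%C = C_derive f z.
Proof.
  intros Hp Hq Hf E Hz.
  symmetry. apply (C_derive_ext_disc f (fun w => p w - lam * q w)%C); auto.
  - intros w Hw. symmetry. now apply E.
  - apply (C_is_derive_minus p (fun w => lam * q w)%C);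
      [now apply analytic_is_derive | ].
    replace (lam * C_derive q z)%C with (0 * q z + lam * C_derive q z)%C by ring.
    apply (C_is_derive_mult (fun _ => lam) q);
      [apply C_is_derive_const | now apply analytic_is_derive].
Qed.

Lemma one_minus_neq_0 (w : C) : unit_disc w -> (1 - w)%C <> 0.
Proof.
  intros Hw E. unfold unit_disc in Hw.
  replace w with (1 - (1 - w))%C in Hw by ring. rewrite E in Hw.
  replace (1 - 0)%C with (RtoC 1) in Hw by ring. rewrite Cmod_1 in Hw. lra.
Qed.

(** Differentiate f w (1 - w lam) = w, which avoids a quotient rule. *)
Lemma C_derive_half_plane_map (lam z : C) (f : C -> C) :
  Cmod lam = 1 -> analytic f -> unit_disc z ->
  (forall w, unit_disc w -> f w = w / (1 - w * lam))%C ->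
  (C_derive f z * (1 - z * lam) ^ 2)%C = 1.
Proof.
  intros Hlam Hf Hz E.
  assert (Hne : forall w, unit_disc w -> (1 - w * lam)%C <> 0).
  { intros w Hw. apply one_minus_neq_0. unfold unit_disc in *.
    rewrite Cmod_mult, Hlam. lra. }
  assert (D1 : C_is_derive (fun w => f w * (1 - w * lam))%C z
                 (C_derive f z * (1 - z * lam) + f z * (0 - (1 * lam + z * 0)))%C).
  { apply (C_is_derive_mult f (fun w => 1 - w * lam)%C);
      [now apply analytic_is_derive | ].
    apply (C_is_derive_minus (fun _ => RtoC 1) (fun w => w * lam)%C);
      [apply C_is_derive_const | ].
    apply (C_is_derive_mult (fun w => w) (fun _ => lam));
      [apply C_is_derive_id | apply C_is_derive_const]. }
  assert (D2 : C_is_derive (fun w => f w * (1 - w * lam))%C z (RtoC 1)).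
  { apply (C_is_derive_ext_disc (fun w => w)); [ | exact Hz | apply C_is_derive_id].
    intros w Hw. rewrite E by exact Hw. field. auto. }
  assert (D := C_is_derive_eq _ _ _ _ D1 D2).
  rewrite E in D by exact Hz.
  replace (C_derive f z * (1 - z * lam) ^ 2)%C
    with ((1 - z * lam) * (C_derive f z * (1 - z * lam) +
            z / (1 - z * lam) * (0 - (1 * lam + z * 0))) + z * lam)%C.
  - rewrite D. ring.
  - simpl. field. auto.
Qed.

(* The dilatation [B'/A' = m (Z - e) / (Z + e)] of the convolution, where [Z]
   has positive real part and [e >= 0] is the condition [b <= (2 - n) / (n + 2)]. *)
Lemma convolution_dilatation (m Z rho : C) (e : R) :
  unit_disc m -> 0 < Re Z -> 0 <= e -> rho <> 0 ->
  Cmod (rho * m * (Z - RtoC e)) < Cmod (rho * (Z + RtoC e)).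
Proof.
  intros Hm HZ He Hr. rewrite !Cmod_mult, Rmult_assoc.
  apply Rmult_lt_compat_l; [now apply Cmod_gt_0 | ].
  unfold unit_disc in Hm.
  assert (H0 := Cmod_ge_0 m). assert (H1 := Cmod_ge_0 (Z - RtoC e)).
  assert (H2 := Cmod_ge_0 (Z + RtoC e)).
  assert (E1 := Cmod2_alt (Z - RtoC e)). assert (E2 := Cmod2_alt (Z + RtoC e)).
  unfold Re, Im in *. simpl in E1, E2.
  assert (Hle : Cmod (Z - RtoC e) <= Cmod (Z + RtoC e)) by nra.
  assert (Hpos : 0 < Cmod (Z + RtoC e)) by nra.
  nra.
Qed.

Lemma cis_plus (x y : R) : cis (x + y) = (cis x * cis y)%C.
Proof.
  unfold cis. rewrite cos_plus, sin_plus. apply C_eq; unfold Re, Im; simpl; ring.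
Qed.

Lemma cis_0 : cis 0 = 1.
Proof. unfold cis. rewrite cos_0, sin_0. reflexivity. Qed.

Lemma cis_opp (x : R) : (cis (- x) * cis x)%C = 1.
Proof. rewrite <- cis_plus, Rplus_opp_l. apply cis_0. Qed.

Lemma Cconj_cis (x : R) : Cconj (cis x) = cis (- x).
Proof. unfold cis, Cconj. now rewrite cos_neg, sin_neg. Qed.

Lemma unit_disc_mult_unimodular (lam z : C) :
  Cmod lam = 1 -> unit_disc z -> unit_disc (lam * z).
Proof. intros Hl Hz. unfold unit_disc in *. rewrite Cmod_mult, Hl. lra. Qed.

Lemma unit_disc_pow (n : nat) (u : C) :
  (0 < n)%nat -> unit_disc u -> unit_disc (u ^ n).
Proof.
  intros Hn Hu. unfold unit_disc in *. rewrite Cmod_pow.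
  destruct n as [ | n]; [lia | ]. assert (H0 := Cmod_ge_0 u).
  simpl. assert (H1 : Cmod u ^ n <= 1 ^ n) by (apply pow_incr; lra).
  rewrite pow1 in H1. assert (0 <= Cmod u ^ n) by now apply pow_le. nra.
Qed.

Lemma quad_factor (eta : R) (u : C) :
  quad (cos eta) u = ((1 + cis eta * u) * (1 + cis (- eta) * u))%C.
Proof.
  unfold quad, cis. rewrite cos_neg, sin_neg.
  assert (H := sin2_cos2 eta). unfold Rsqr in H.
  replace (u * u)%C with (RtoC (sin eta * sin eta + cos eta * cos eta) * (u * u))%C
    by (rewrite H; ring).
  apply C_eq; unfold Re, Im; simpl; ring.
Qed.

(** The denominator is a product of three binomials with unimodular coefficients, divided out one at
    a time; the resulting series is rho'. *)
Lemma shear_kernel_exists (n : nat) (eta : R) (mu : C) :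
  (0 < n)%nat -> Cmod mu = 1 ->
  exists c, poly_bounded c /\ forall u, unit_disc u ->
    (power_series c u * (quad (cos eta) u * (1 - mu * u ^ n)))%C = 1.
Proof.
  intros Hn Hmu.
  destruct (power_series_div_binomial 1 (- cis eta) one_coef) as (c1 & B1 & E1);
    [lia | rewrite Cmod_opp, Cmod_cis; lra | apply poly_bounded_one | ].
  destruct (power_series_div_binomial 1 (- cis (- eta)) c1) as (c2 & B2 & E2);
    [lia | rewrite Cmod_opp, Cmod_cis; lra | exact B1 | ].
  destruct (power_series_div_binomial n mu c2) as (c3 & B3 & E3);
    [exact Hn | lra | exact B2 | ].
  exists c3. split; [exact B3 | ]. intros u Hu.
  transitivity (power_series one_coef u); [ | apply power_series_one].
  rewrite <- E1, <- E2, <- E3, quad_factor by exact Hu. simpl. ring.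
Qed.

(** * The derivatives of A and B in closed form *)

Section Convolution_derivatives.

Variables (n : nat) (cs a d : R) (mu : C) (c : nat -> C).
Hypothesis n_pos : (0 < n)%nat.
Hypothesis Hcs : -1 <= cs <= 1.
Hypothesis Hmu : Cmod mu = 1.
Hypothesis Had : a + d = 1.
Hypothesis c_bounded : poly_bounded c.
Hypothesis c_kernel : forall u, unit_disc u ->
  (power_series c u * (quad cs u * (1 - mu * u ^ n)))%C = 1.

(* With [rho' = power_series c] and [sigma' = mu u^n rho'], these are the
   coefficients of [a u rho' + d rho] and [a u sigma' - d sigma]. *)
Definition conv_an_coef (k : nat) : C := (RtoC (a * INR k + d) * int_coef c k)%C.
Definition conv_coan_coef (k : nat) : C :=
  (RtoC (a * INR k - d) * int_coef (fun j => mu * shift_n n c j)%C k)%C.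

Let m (u : C) : C := (mu * u ^ n)%C.
Let P (u : C) : C := ((1 - u * u) / quad cs u)%C.
Let H (u : C) : C := ((1 + m u) / (1 - m u))%C.
Let Z (u : C) : C := (RtoC a * P u + RtoC (a * INR n / 2) * H u)%C.
Let e : R := 1 - a - a * INR n / 2.

Let m_disc (u : C) : unit_disc u -> unit_disc (m u).
Proof. intros Hu. apply unit_disc_mult_unimodular; auto using unit_disc_pow. Qed.

Let poly_bounded_linear (x y : R) :
  poly_bounded (fun k => RtoC (x * INR k + y)).
Proof.
  destruct (poly_bounded_plus _ _
    (poly_bounded_mult _ _ (poly_bounded_const (RtoC x)) poly_bounded_index)
    (poly_bounded_const (RtoC y))) as (M & p & HM & Hb).
  exists M, p. split; [exact HM | ]. intros k. rewrite RtoC_plus, RtoC_mult. apply Hb.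
Qed.

Lemma conv_an_bounded : poly_bounded conv_an_coef.
Proof.
  apply poly_bounded_mult; [apply poly_bounded_linear | now apply poly_bounded_int].
Qed.

Lemma conv_coan_bounded : poly_bounded conv_coan_coef.
Proof.
  apply poly_bounded_mult.
  - exact (poly_bounded_linear a (- d)).
  - apply poly_bounded_int, poly_bounded_mult;
      [apply poly_bounded_const | now apply poly_bounded_shift_n].
Qed.

Let kernel_neq_0 (u : C) : unit_disc u -> power_series c u <> 0.
Proof.
  intros Hu E. assert (K := c_kernel u Hu). rewrite E, Cmult_0_l in K.
  apply RtoC_inj in K. lra.
Qed.

(** Logarithmic derivative of 1/(Q(1-m)): -u Q'/Q = P - 1 because u Q' = Q - (1-u^2), and u m'/(1-m)
    = n m/(1-m) = (n/2)(H - 1). *)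
Lemma kernel_log_derivative (u : C) : unit_disc u ->
  (u * power_series (derive_coef c) u)%C =
  (power_series c u * (P u - 1 + RtoC (INR n / 2) * (H u - 1)))%C.
Proof.
  intros Hu.
  assert (D1 := C_is_derive_mult _ _ _ _ _ (is_derive_power_series c u c_bounded Hu)
    (C_is_derive_mult _ _ _ _ _
      (C_is_derive_plus _ _ u _ _
        (C_is_derive_plus (fun _ => RtoC 1) (fun w => 2 * RtoC cs * w)%C u _ _
           (C_is_derive_const 1 u)
           (C_is_derive_mult (fun _ => (2 * RtoC cs)%C) (fun w => w) u _ _
              (C_is_derive_const _ u) (C_is_derive_id u)))
        (C_is_derive_mult (fun w => w) (fun w => w) u _ _
           (C_is_derive_id u) (C_is_derive_id u)))
      (C_is_derive_minus (fun _ => RtoC 1) (fun w => mu * w ^ n)%C u _ _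
        (C_is_derive_const 1 u)
        (C_is_derive_mult (fun _ => mu) (fun w => w ^ n)%C u _ _
           (C_is_derive_const mu u) (C_is_derive_pow n u))))).
  cbv beta in D1.
  assert (D2 : C_is_derive (fun w => power_series c w *
             ((1 + 2 * RtoC cs * w + w * w) * (1 - mu * w ^ n)))%C u (RtoC 0)).
  { apply (C_is_derive_ext_disc (fun _ => RtoC 1)); [ | exact Hu | apply C_is_derive_const].
    intros w Hw. symmetry. now apply c_kernel. }
  assert (D := C_is_derive_eq _ _ _ _ D1 D2). clear D1 D2.
  assert (K := c_kernel u Hu). assert (Hq := quad_neq_0 cs u Hcs Hu).
  assert (Hm := one_minus_neq_0 _ (m_disc u Hu)).
  set (r2 := power_series (derive_coef c) u) in *. set (r := power_series c u) in *.
  assert (Hun : (u * (RtoC (INR n) * u ^ pred n))%C = (RtoC (INR n) * u ^ n)%C).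
  { destruct n as [ | n']; [lia | ]. simpl pred. rewrite Cpow_S. ring. }
  unfold H, P. unfold m in *. set (M := (mu * u ^ n)%C) in *.
  assert (D' : (u * r2 * (quad cs u * (1 - M)) +
     r * ((2 * RtoC cs * u + 2 * u * u) * (1 - M) - quad cs u * (RtoC (INR n) * M)))%C = 0).
  { transitivity (u * 0)%C; [ | ring]. rewrite <- D. unfold quad, M.
    replace (RtoC (INR n) * (mu * u ^ n))%C with (mu * (RtoC (INR n) * u ^ n))%C by ring.
    rewrite <- Hun. ring. }
  replace (u * r2)%C with
    (- (r * ((2 * RtoC cs * u + 2 * u * u) * (1 - M) - quad cs u * (RtoC (INR n) * M))) /
     (quad cs u * (1 - M)))%C.
  - unfold Rdiv. rewrite RtoC_mult, RtoC_inv by lra.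
    replace (2 * RtoC cs * u + 2 * u * u)%C with (quad cs u - (1 - u * u))%C
      by (unfold quad; ring).
    field. auto.
  - replace (- (r * ((2 * RtoC cs * u + 2 * u * u) * (1 - M) - quad cs u * (RtoC (INR n) * M))))%C
      with (u * r2 * (quad cs u * (1 - M)))%C.
    + field. auto.
    + match type of D' with (?x + ?y)%C = _ =>
        replace x with ((x + y) - y)%C by ring end.
      rewrite D'. ring.
Qed.

Let power_series_linear (x y : R) (u : C) : unit_disc u ->
  power_series (fun k => RtoC (x * INR k + y) * c k)%C u =
  (RtoC x * (u * power_series (derive_coef c) u) + RtoC y * power_series c u)%C.
Proof.
  intros Hu. assert (Hd := poly_bounded_derive c c_bounded).
  rewrite (power_series_ext _
    (fun k => RtoC x * shift (derive_coef c) k + RtoC y * c k)%C).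
  - rewrite (power_series_plus (fun k => RtoC x * shift (derive_coef c) k)%C
              (fun k => RtoC y * c k)%C), !power_series_scal, power_series_shift;
      auto using poly_bounded_shift, poly_bounded_mult, poly_bounded_const.
  - intros [ | k]; unfold shift, derive_coef; rewrite RtoC_plus, RtoC_mult.
    + simpl. ring.
    + ring.
Qed.

(** A' = a u rho'' + rho' because a + d = 1; the constants left by the logarithmic derivative add up
    to [e]. *)
Lemma conv_an_derive (u : C) : unit_disc u ->
  power_series (derive_coef conv_an_coef) u = (power_series c u * (Z u + RtoC e))%C.
Proof.
  intros Hu.
  rewrite (power_series_ext _ (fun k => RtoC (a * INR k + 1) * c k)%C).
  - rewrite power_series_linear, kernel_log_derivative by exact Hu.
    unfold Z, e, Rdiv. rewrite !RtoC_minus, !RtoC_mult, RtoC_inv by lra.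
    field.
  - intros k. rewrite <- (derive_int_coef c k).
    unfold conv_an_coef, derive_coef. rewrite S_INR.
    replace (a * (INR k + 1) + d) with (a * INR k + 1) by lra. ring.
Qed.

Lemma conv_coan_derive (u : C) : unit_disc u ->
  power_series (derive_coef conv_coan_coef) u =
  (power_series c u * m u * (Z u - RtoC e))%C.
Proof.
  intros Hu.
  (* B' has coefficients a (k+1) - d against those of mu u^n rho'; putting k = n + j gives a j + (a
     n + a - d). *)
  set (g := fun j => (RtoC (a * INR j + (a * INR n + a - d)) * c j)%C).
  assert (Hg : poly_bounded g) by (apply poly_bounded_mult; auto).
  rewrite (power_series_ext _ (fun k => mu * shift_n n g k)%C).
  - rewrite power_series_scal, power_series_shift_n
      by auto using poly_bounded_shift_n.
    unfold g. rewrite power_series_linear, kernel_log_derivative by exact Hu.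
    unfold m, Z, e, Rdiv. replace d with (1 - a) by lra.
    rewrite !RtoC_minus, !RtoC_plus, !RtoC_mult, RtoC_inv, ?RtoC_minus by lra.
    field.
  - intros k.
    transitivity (RtoC (a * INR (S k) - d) * (mu * shift_n n c k))%C.
    + rewrite <- (derive_int_coef (fun j => mu * shift_n n c j)%C k).
      unfold conv_coan_coef, derive_coef. ring.
    + destruct (Nat.lt_ge_cases k n) as [L | L].
      * rewrite !shift_n_lt by exact L. ring.
      * replace k with (n + (k - n))%nat by lia. rewrite !shift_n_add.
        unfold g. rewrite S_INR, plus_INR.
        replace (a * (INR n + INR (k - n) + 1) - d)
          with (a * INR (k - n) + (a * INR n + a - d)) by ring. ring.
Qed.

Hypothesis a_pos : 0 < a.
Hypothesis e_nonneg : 0 <= 1 - a - a * INR n / 2.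

Let Re_H_pos (u : C) : unit_disc u -> 0 < Re (H u).
Proof. intros Hu. apply Re_half_plane_map_pos. now apply m_disc. Qed.

Lemma conv_dilatation (u : C) : unit_disc u ->
  Cmod (power_series (derive_coef conv_coan_coef) u) <
  Cmod (power_series (derive_coef conv_an_coef) u).
Proof.
  intros Hu. rewrite conv_an_derive, conv_coan_derive by exact Hu.
  apply convolution_dilatation; auto.
  assert (H1 := Re_quad_quotient_pos cs u Hcs Hu). fold (P u) in H1.
  assert (H2 := Re_H_pos u Hu). assert (Hn := pos_INR n).
  assert (E : Re (Z u) = a * Re (P u) + a * INR n / 2 * Re (H u)).
  { unfold Z. generalize (P u) (H u). intros x y. unfold Re. simpl. ring. }
  rewrite E. assert (0 <= a * INR n / 2) by nra. nra.
Qed.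

(** (A'-B') Q = Z + e H after cancelling rho' Q (1-m) = 1, and e + an/2 = d. *)
Lemma conv_shear_derive (u : C) : unit_disc u ->
  ((power_series (derive_coef conv_an_coef) u -
    power_series (derive_coef conv_coan_coef) u) * quad cs u)%C =
  (RtoC a * ((1 - u * u) / quad cs u) + RtoC d * ((1 + mu * u ^ n) / (1 - mu * u ^ n)))%C.
Proof.
  intros Hu. rewrite conv_an_derive, conv_coan_derive by exact Hu.
  assert (Hq := quad_neq_0 cs u Hcs Hu).
  assert (Hm := one_minus_neq_0 _ (m_disc u Hu)).
  assert (K := c_kernel u Hu). fold (m u) in *. fold (H u).
  assert (Er : power_series c u = (1 / (quad cs u * (1 - m u)))%C).
  { rewrite <- K at 1. field. auto. }
  rewrite Er. fold (P u). unfold Z, e, Rdiv. replace d with (1 - a) by lra.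
  generalize (P u). intros p. unfold H.
  rewrite !RtoC_minus, !RtoC_mult, RtoC_inv by lra.
  field. auto.
Qed.

End Convolution_derivatives.

(** * Hadamard products and the theorem *)

Lemma poly_bounded_geometric (c : nat -> C) (lam : C) :
  poly_bounded c -> Cmod lam = 1 -> poly_bounded (fun k => c k * lam ^ k)%C.
Proof.
  intros Hc Hl. apply poly_bounded_mult; [exact Hc | apply poly_bounded_pow; lra].
Qed.

Lemma power_series_half_plane_shear (x y lam K z : C) :
  Cmod lam = 1 -> unit_disc z ->
  (power_series (fun k => K * (RtoC (INR (S k)) * (x * RtoC (INR (S k)) + y) * lam ^ k)) z *
     (1 - z * lam) ^ 3)%C = (K * ((x + y) + (x - y) * (z * lam)))%C.
Proof.
  intros Hl Hz.
  rewrite power_series_scal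
    by auto using poly_bounded_geometric, poly_bounded_quadratic.
  rewrite (power_series_scale_arg
             (fun k => RtoC (INR (S k)) * (x * RtoC (INR (S k)) + y))%C lam z).
  rewrite (Cmult_comm z lam), <- Cmult_assoc, power_series_quadratic
    by now apply unit_disc_mult_unimodular.
  reflexivity.
Qed.

Lemma hadamard_power_series (f F : C -> C) (c d : nat -> C) :
  poly_bounded c -> poly_bounded d ->
  (forall z, unit_disc z -> f z = power_series c z) ->
  (forall z, unit_disc z -> F z = power_series d z) ->
  forall z, hadamard f F z = power_series (fun k => c k * d k)%C z.
Proof.
  intros Hc Hd Hf HF z. unfold hadamard, power_series, C_series.
  f_equal; apply Series_ext; intros k;
    now rewrite (taylor_coef_power_series f c), (taylor_coef_power_series F d).
Qed.

Lemma hadamard_rotated (f F : C -> C) (c d e : nat -> C) (K lam : C) :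
  poly_bounded c -> poly_bounded d -> poly_bounded e -> Cmod lam = 1 ->
  (forall z, unit_disc z -> f z = power_series (int_coef c) z) ->
  (forall z, unit_disc z -> F z = power_series (int_coef d) z) ->
  e 0%nat = 0 ->
  (forall k, int_coef c (S k) * int_coef d (S k) = K * (e (S k) * lam ^ S k))%C ->
  forall z, unit_disc z -> hadamard f F z = (K * power_series e (lam * z))%C.
Proof.
  intros Hc Hd He Hl Hf HF E0 ES z Hz.
  rewrite (hadamard_power_series f F (int_coef c) (int_coef d))
    by auto using poly_bounded_int.
  rewrite <- power_series_scale_arg, <- power_series_scal
    by auto using poly_bounded_geometric.
  apply power_series_ext. intros [ | k]; [ | apply ES].
  rewrite E0. simpl. ring.
Qed.

Theorem theorem3p2 (n : nat) (theta eta alpha gamma b : R) (c : C)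
    (h g r s f : C -> C)
    (hn : (0 < n)%nat)
    (halpha : 0 <= alpha < 2 * PI)
    (hgamma : 0 <= gamma < 2 * PI)
    (hb : -1 < b < 1)
    (hfb_SH : in_SH_norm c (HMap h g))
    (hfb_shear : forall z : C, unit_disc z ->
       (h z - cis (- 2 * alpha) * g z = z / (1 - z * cis alpha))%C)
    (hfb_dil : has_dilatation (HMap h g) (fun z : C =>
       (cis (2 * alpha) *
          ((RtoC b + z * cis alpha) / (1 + RtoC b * z * cis alpha)))%C))
    (ht_SH : in_SH (HMap r s))
    (ht_shear : forall z : C, unit_disc z ->
       (r z - cis (- 2 * gamma) * s z = f z)%C)
    (ht_dil : has_dilatation (HMap r s) (fun z : C => (cis theta * z ^ n)%C))
    (hf_analytic : analytic f)
    (hf : forall z : C, unit_disc z ->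
       (z * C_derive f z =
          z / ((1 + z * cis (eta + gamma)) * (1 + z * cis (- (eta - gamma)))))%C)
    (hbn : b <= - (INR n - 2) / (INR n + 2)) :
  in_SH_norm c (harmonic_convolution (HMap h g) (HMap r s)) /\
  map_convex_in_direction (- (alpha + gamma))
    (harmonic_convolution (HMap h g) (HMap r s)).
Proof.
  destruct hfb_SH as (h_an & g_an & _ & h0 & g0 & hc).
  destruct ht_SH as (r_an & s_an & _ & r0 & s0 & rc1).
  simpl in h_an, g_an, h0, g0, hc, r_an, s_an, r0, s0, rc1.
  (* The solution of a + d = 1, a - d = b, which matches [power_series_quadratic] to the numerator 1
     + b w of h'. *)
  set (a := (1 + b) / 2). set (d := (1 - b) / 2).
  set (Ea := cis alpha) in *. set (Eg := cis gamma) in *.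
  assert (MEa : Cmod Ea = 1) by apply Cmod_cis.
  assert (MEg : Cmod Eg = 1) by apply Cmod_cis.
  assert (NEa : Ea <> 0) by apply cis_neq_0.
  assert (NEg : Eg <> 0) by apply cis_neq_0.
  assert (E2a : cis (2 * alpha) = (Ea * Ea)%C).
  { unfold Ea. rewrite <- cis_plus. f_equal. ring. }
  assert (E2a' : (cis (- 2 * alpha) * (Ea * Ea))%C = 1).
  { rewrite <- E2a. replace (- 2 * alpha) with (- (2 * alpha)) by ring. apply cis_opp. }
  assert (E2g' : (cis (- 2 * gamma) * (Eg * Eg))%C = 1).
  { unfold Eg. rewrite <- !cis_plus. rewrite <- cis_0. f_equal. ring. }
  set (B1 := RtoC (/ (1 - b))).
  assert (HB1 : (B1 * (1 - RtoC b))%C = 1).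
  { unfold B1. rewrite <- RtoC_minus, <- RtoC_mult. f_equal. field. lra. }
  assert (Had : a + d = 1) by (unfold a, d; field).
  assert (Had_b : a - d = b) by (unfold a, d; field).
  set (hcoef := fun k => (B1 * (RtoC (INR (S k)) *
                  (RtoC a * RtoC (INR (S k)) + RtoC d) * Ea ^ k))%C).
  set (gcoef := fun k => (B1 * (Ea * Ea) * (RtoC (INR (S k)) *
                  (RtoC a * RtoC (INR (S k)) + RtoC (- d)) * Ea ^ k))%C).
  assert (Hh_b : poly_bounded hcoef).
  { apply poly_bounded_mult; auto using poly_bounded_const, poly_bounded_geometric,
      poly_bounded_quadratic. }
  assert (Hg_b : poly_bounded gcoef).
  { apply poly_bounded_mult; auto using poly_bounded_const, poly_bounded_geometric,
      poly_bounded_quadratic. }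
  assert (Hderiv_hg : forall z, unit_disc z ->
            C_derive h z = power_series hcoef z /\ C_derive g z = power_series gcoef z).
  { intros z Hz.
    assert (Hw : unit_disc (z * Ea)).
    { rewrite Cmult_comm. now apply unit_disc_mult_unimodular. }
    assert (W1 := one_minus_neq_0 _ Hw).
    assert (W2 : (1 + RtoC b * z * Ea)%C <> 0).
    { replace (1 + RtoC b * z * Ea)%C with (1 - RtoC (- b) * (z * Ea))%C
        by (rewrite RtoC_opp; ring).
      apply one_minus_neq_0. unfold unit_disc in *.
      rewrite Cmod_mult, Cmod_R, Rabs_Ropp.
      assert (Rabs b < 1) by (apply Rabs_def1; lra).
      assert (H0 := Cmod_ge_0 (z * Ea)). assert (H1 := Rabs_pos b). nra. }
    assert (Fan : analytic (fun w => h w - cis (- 2 * alpha) * g w)%C).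
    { intros w Hw'. eexists.
      apply (C_is_derive_minus h (fun v => cis (- 2 * alpha) * g v)%C);
        [now apply analytic_is_derive | ].
      apply (C_is_derive_mult (fun _ => cis (- 2 * alpha)) g);
        [apply C_is_derive_const | now apply analytic_is_derive]. }
    assert (F1 := C_derive_half_plane_map Ea z _ MEa Fan Hz hfb_shear).
    rewrite <- (C_derive_shear h g _ (cis (- 2 * alpha)) z h_an g_an Fan
                  (fun w _ => eq_refl) Hz) in F1.
    destruct (hfb_dil z Hz) as [Hne Hdil]. simpl in Hne, Hdil.
    assert (Hg' : C_derive g z = (C_derive h z * (Ea * Ea *
                ((RtoC b + z * Ea) / (1 + RtoC b * z * Ea))))%C).
    { rewrite <- E2a, <- Hdil. field. exact Hne. }
    (* With w = z e^(i alpha): 1 - (b+w)/(1+bw) = (1-b)(1-w)/(1+bw), and the shear gives the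
       remaining (1-w)^2. *)
    assert (Hh' : (C_derive h z * (1 - z * Ea) ^ 3)%C = (B1 * (1 + RtoC b * z * Ea))%C).
    { rewrite Hg' in F1.
      transitivity (B1 * (1 + RtoC b * z * Ea) *
        ((C_derive h z - cis (- 2 * alpha) * (C_derive h z * (Ea * Ea *
            ((RtoC b + z * Ea) / (1 + RtoC b * z * Ea))))) * (1 - z * Ea) ^ 2))%C.
      2: { rewrite F1. ring. }
      replace (cis (- 2 * alpha) * (C_derive h z * (Ea * Ea *
            ((RtoC b + z * Ea) / (1 + RtoC b * z * Ea)))))%C
        with (cis (- 2 * alpha) * (Ea * Ea) * (C_derive h z *
            ((RtoC b + z * Ea) / (1 + RtoC b * z * Ea))))%C by ring.
      rewrite E2a'.
      transitivity (B1 * (1 - RtoC b) * (C_derive h z * (1 - z * Ea) ^ 3))%C;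
        [rewrite HB1; ring | ].
      simpl. field. exact W2. }
    assert (W3 : ((1 - z * Ea) ^ 3)%C <> 0) by now apply Cpow_nz.
    assert (Hcancel : forall x y, (x * (1 - z * Ea) ^ 3 = y * (1 - z * Ea) ^ 3)%C -> x = y).
    { intros x y Hxy.
      replace x with (x * (1 - z * Ea) ^ 3 / (1 - z * Ea) ^ 3)%C by (field; auto).
      rewrite Hxy. field. auto. }
    split; apply Hcancel.
    - rewrite Hh'. unfold hcoef. rewrite power_series_half_plane_shear by auto.
      rewrite <- RtoC_plus, <- RtoC_minus, Had, Had_b. ring.
    - rewrite Hg'. unfold gcoef. rewrite power_series_half_plane_shear by auto.
      rewrite <- RtoC_plus, <- RtoC_minus.
      replace (a + - d) with b by lra. replace (a - - d) with 1 by lra.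
      transitivity (C_derive h z * (1 - z * Ea) ^ 3 *
         (Ea * Ea * ((RtoC b + z * Ea) / (1 + RtoC b * z * Ea))))%C; [ring | ].
      rewrite Hh'. field. exact W2. }
  assert (Hh : forall z, unit_disc z -> h z = power_series (int_coef hcoef) z).
  { apply primitive_power_series; auto. apply Hderiv_hg. }
  assert (Hg : forall z, unit_disc z -> g z = power_series (int_coef gcoef) z).
  { apply primitive_power_series; auto. apply Hderiv_hg. }
  (* Chosen so that e^(i theta) z^n = e^(2 i gamma) mu u^n with u = e^(i gamma) z; the shear of
     t_(eta,gamma) cancels e^(2 i gamma). *)
  set (mu := (cis theta * (cis (- 2 * gamma) * cis (- gamma) ^ n))%C).
  assert (Mmu : Cmod mu = 1).
  { unfold mu. rewrite !Cmod_mult, Cmod_pow, !Cmod_cis, pow1. ring. }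
  assert (Hmu : forall z, (cis theta * z ^ n)%C = (Eg * Eg * (mu * (Eg * z) ^ n))%C).
  { intros z. unfold mu.
    transitivity (cis (- 2 * gamma) * (Eg * Eg) * (cis (- gamma) * Eg) ^ n *
                  (cis theta * z ^ n))%C.
    - rewrite E2g'. unfold Eg. rewrite cis_opp, Cpow_1_l. ring.
    - rewrite !Cpow_mult_l. ring. }
  destruct (shear_kernel_exists n eta mu hn Mmu) as (kc & Hkc & Hker).
  set (rcoef := fun k => (kc k * Eg ^ k)%C).
  set (sk := fun k => (mu * shift_n n kc k)%C).
  set (scoef := fun k => (Eg * Eg * (sk k * Eg ^ k))%C).
  assert (Hsk : poly_bounded sk).
  { apply poly_bounded_mult; auto using poly_bounded_const, poly_bounded_shift_n. }
  assert (Hr_b : poly_bounded rcoef) by now apply poly_bounded_geometric.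
  assert (Hs_b : poly_bounded scoef).
  { apply poly_bounded_mult; auto using poly_bounded_const, poly_bounded_geometric. }
  assert (Hderiv_rs : forall z, unit_disc z ->
            C_derive r z = power_series rcoef z /\ C_derive s z = power_series scoef z).
  { intros z Hz. set (u := (Eg * z)%C).
    assert (Hu : unit_disc u) by now apply unit_disc_mult_unimodular.
    assert (K := Hker u Hu).
    assert (Hq : quad (cos eta) u <> 0)
      by (apply quad_neq_0; [apply COS_bound | exact Hu]).
    assert (Hm : (1 - mu * u ^ n)%C <> 0).
    { apply one_minus_neq_0, unit_disc_mult_unimodular; auto using unit_disc_pow. }
    assert (Hr1 : C_derive r z = power_series kc u).
    (* The equation for z f' says nothing at z = 0; there the normalization r'(0) = 1 gives the
       value. *)
    { destruct (Ceq_dec z 0) as [-> | Hz0].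
      - rewrite rc1. unfold u in *. rewrite Cmult_0_r in *.
        destruct n as [ | n']; [lia | ].
        rewrite Cpow_S in K. unfold quad in K. rewrite <- K. ring.
      - destruct (ht_dil z Hz) as [Hne Hdil]. simpl in Hne, Hdil.
        assert (Hs' : C_derive s z = (C_derive r z * (Eg * Eg * (mu * u ^ n)))%C).
        { unfold u. rewrite <- Hmu, <- Hdil. field. exact Hne. }
        assert (Hf := C_derive_shear r s f _ z r_an s_an hf_analytic ht_shear Hz).
        rewrite Hs' in Hf.
        assert (Hquad : ((1 + z * cis (eta + gamma)) *
                  (1 + z * cis (- (eta - gamma))))%C = quad (cos eta) u).
        { rewrite quad_factor. unfold u.
          replace (- (eta - gamma)) with (- eta + gamma) by ring.
          rewrite !cis_plus. fold Eg. ring. }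
        assert (Hf' := hf z Hz). rewrite Hquad, <- Hf in Hf'.
        assert (Hf2 : (C_derive r z * (1 - mu * u ^ n) * quad (cos eta) u)%C = 1).
        { transitivity ((z * (C_derive r z - cis (- 2 * gamma) *
             (C_derive r z * (Eg * Eg * (mu * u ^ n))))) * quad (cos eta) u / z)%C.
          - replace (cis (- 2 * gamma) * (C_derive r z * (Eg * Eg * (mu * u ^ n))))%C
              with (cis (- 2 * gamma) * (Eg * Eg) * (C_derive r z * (mu * u ^ n)))%C by ring.
            rewrite E2g'. field. exact Hz0.
          - rewrite Hf'. field. auto. }
        transitivity (C_derive r z * (1 - mu * u ^ n) * quad (cos eta) u /
                      (quad (cos eta) u * (1 - mu * u ^ n)))%C; [field; auto | ].
        rewrite Hf2.
        transitivity (power_series kc u * (quad (cos eta) u * (1 - mu * u ^ n)) /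
                      (quad (cos eta) u * (1 - mu * u ^ n)))%C; [now rewrite K | field; auto]. }
    split.
    - rewrite Hr1. unfold rcoef. now rewrite power_series_scale_arg.
    - destruct (ht_dil z Hz) as [Hne Hdil]. simpl in Hne, Hdil.
      unfold scoef. rewrite power_series_scal, power_series_scale_arg
        by auto using poly_bounded_geometric.
      fold u. unfold sk.
      rewrite power_series_scal, power_series_shift_n by auto using poly_bounded_shift_n.
      rewrite <- Hr1.
      transitivity (C_derive s z / C_derive r z * C_derive r z)%C; [field; exact Hne | ].
      rewrite Hdil, Hmu. fold u. ring. }
  assert (Hr : forall z, unit_disc z -> r z = power_series (int_coef rcoef) z).
  { apply primitive_power_series; auto. apply Hderiv_rs. }
  assert (Hs : forall z, unit_disc z -> s z = power_series (int_coef scoef) z).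
  { apply primitive_power_series; auto. apply Hderiv_rs. }
  set (L := cis (alpha + gamma)).
  assert (EL : L = (Ea * Eg)%C) by apply cis_plus.
  assert (ML : Cmod L = 1) by apply Cmod_cis.
  set (Ac := conv_an_coef a d kc). set (Bc := conv_coan_coef n a d mu kc).
  assert (HAc : poly_bounded Ac) by now apply conv_an_bounded.
  assert (HBc : poly_bounded Bc) by now apply conv_coan_bounded.
  assert (HINR : forall k, RtoC (INR (S k)) <> 0).
  { intros k E. apply RtoC_inj in E. exact (not_0_INR (S k) (Nat.neq_succ_0 k) E). }
  (* Integration shifts the index: z^(k+1) comes with L^k, whence the factor 1/L. In [Hcoan] the
     extra e^(2i(alpha+gamma)) turns it into L. *)
  assert (Han : forall z, unit_disc z ->
            hadamard h r z = (B1 * cis (- (alpha + gamma)) * power_series Ac (L * z))%C).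
  { apply (hadamard_rotated h r hcoef rcoef); auto.
    - unfold Ac, conv_an_coef. simpl. ring.
    - intros k. assert (E1 := cis_opp (alpha + gamma)). fold L in E1.
      rewrite Cpow_S.
      transitivity (cis (- (alpha + gamma)) * L * (B1 * (Ac (S k) * L ^ k)))%C; [ | ring].
      rewrite E1, EL, Cpow_mult_l.
      unfold Ac, conv_an_coef, int_coef, hcoef, rcoef.
      rewrite RtoC_plus, RtoC_mult. field. apply HINR. }
  assert (Hcoan : forall z, unit_disc z ->
            hadamard g s z = (B1 * L * power_series Bc (L * z))%C).
  { apply (hadamard_rotated g s gcoef scoef); auto.
    - unfold Bc, conv_coan_coef. simpl. ring.
    - intros k. rewrite Cpow_S, EL, Cpow_mult_l.
      unfold Bc, conv_coan_coef, int_coef, gcoef, scoef. fold (sk k).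
      rewrite RtoC_minus, RtoC_mult, RtoC_opp. field. apply HINR. }
  set (A := power_series Ac) in *. set (B := power_series Bc) in *.
  (* Since B1 is real and the conjugate of L is 1/L, both parts carry the same factor. *)
  assert (HT : forall z, unit_disc z ->
    heval (harmonic_convolution (HMap h g) (HMap r s)) z =
    (RtoC (/ (1 - b)) * cis (- (alpha + gamma)) * (A (L * z)%C + Cconj (B (L * z)%C)))%C).
  { intros z Hz. unfold heval, harmonic_convolution. simpl.
    rewrite Han, Hcoan, !Cmult_conj by exact Hz.
    unfold L at 2. rewrite Cconj_cis.
    replace (Cconj B1) with B1 by (unfold B1; apply C_eq; unfold Re, Im; simpl; ring).
    fold B1. ring. }
  assert (Hk : / (1 - b) <> 0) by (apply Rinv_neq_0_compat; lra).
  assert (HA : forall u, unit_disc u -> C_is_derive A u (power_series (derive_coef Ac) u))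
    by (intros; now apply is_derive_power_series).
  assert (HB : forall u, unit_disc u -> C_is_derive B u (power_series (derive_coef Bc) u))
    by (intros; now apply is_derive_power_series).
  assert (Ha : 0 < a) by (unfold a; lra).
  assert (Hd : 0 <= d) by (unfold d; lra).
  assert (Hcs := COS_bound eta).
  (* Equivalent to (1+b)(n+2) <= 4, which is the bound on b multiplied by n + 2. *)
  assert (He : 0 <= 1 - a - a * INR n / 2).
  { assert (Hn := pos_INR n). unfold a.
    apply (Rmult_le_compat_r (INR n + 2)) in hbn; [ | lra].
    unfold Rdiv in hbn at 1. rewrite Rmult_assoc, Rinv_l in hbn by lra. nra. }
  assert (Hdilat : forall u, unit_disc u ->
    Cmod (power_series (derive_coef Bc) u) < Cmod (power_series (derive_coef Ac) u)).
  { intros u Hu. now apply (conv_dilatation n (cos eta)). }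
  set (Hm := fun u => ((1 + mu * u ^ n) / (1 - mu * u ^ n))%C).
  assert (HmR : forall u, unit_disc u -> 0 < Re (Hm u)).
  { intros u Hu. apply Re_half_plane_map_pos, unit_disc_mult_unimodular;
      auto using unit_disc_pow. }
  assert (Hshear : forall u, unit_disc u ->
    ((power_series (derive_coef Ac) u - power_series (derive_coef Bc) u) *
       quad (cos eta) u)%C =
    (RtoC a * ((1 - u * u) / quad (cos eta) u) + RtoC d * Hm u)%C).
  { intros u Hu. now apply (conv_shear_derive n (cos eta)). }
  split.
  - split; [ | split; [ | split; [ | split; [ | split]]]]; simpl.
    + intros z Hz. eexists.
      apply (C_is_derive_ext_disc (power_series (fun k => int_coef hcoef k * int_coef rcoef k)%C));
        [ | exact Hz | ].
      * intros w _. symmetry. apply hadamard_power_series; auto using poly_bounded_int.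
      * apply is_derive_power_series; auto using poly_bounded_mult, poly_bounded_int.
    + intros z Hz. eexists.
      apply (C_is_derive_ext_disc (power_series (fun k => int_coef gcoef k * int_coef scoef k)%C));
        [ | exact Hz | ].
      * intros w _. symmetry. apply hadamard_power_series; auto using poly_bounded_int.
      * apply is_derive_power_series; auto using poly_bounded_mult, poly_bounded_int.
    + intros z w Hz Hw E. rewrite !HT in E by auto.
      assert (NL : L <> 0) by apply cis_neq_0.
      assert (NK : (RtoC (/ (1 - b)) * cis (- (alpha + gamma)))%C <> 0).
      { apply Cmult_neq_0; [ | apply cis_neq_0]. intros E'. apply RtoC_inj in E'. auto. }
      assert (Eu : (L * z)%C = (L * w)%C).
      { apply (disc_shear_univalent (cos eta) a d A B (power_series (derive_coef Ac))
                 (power_series (derive_coef Bc)) Hm);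
          auto using unit_disc_mult_unimodular.
        set (K := (RtoC (/ (1 - b)) * cis (- (alpha + gamma)))%C) in *.
        set (x := (_ + _)%C) in E. set (y := (_ + _)%C) in E.
        change (x = y). clearbody x y.
        replace x with (K * x / K)%C by (field; exact NK).
        rewrite E. field. exact NK. }
      replace z with (L * z / L)%C by (field; exact NL).
      rewrite Eu. field. exact NL.
    + rewrite (hadamard_power_series h r (int_coef hcoef) (int_coef rcoef)),
        power_series_0; auto using poly_bounded_int. simpl. ring.
    + rewrite (hadamard_power_series g s (int_coef gcoef) (int_coef scoef)),
        power_series_0; auto using poly_bounded_int. simpl. ring.
    (* The linear coefficient of the product is h'(0) r'(0), that is, c times 1. *)
    + assert (E0 := proj1 (Hderiv_hg 0 unit_disc_0)). rewrite hc, power_series_0 in E0.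
      assert (E1 := proj1 (Hderiv_rs 0 unit_disc_0)). rewrite rc1, power_series_0 in E1.
      rewrite (C_derive_ext_disc _ (power_series (fun k => int_coef hcoef k * int_coef rcoef k)%C)
                 0 (power_series
                      (derive_coef (fun k => int_coef hcoef k * int_coef rcoef k)%C) 0)).
      * rewrite power_series_0. unfold derive_coef, int_coef.
        rewrite <- E0, <- E1. simpl. field.
      * intros w _. apply hadamard_power_series; auto using poly_bounded_int.
      * exact unit_disc_0.
      * apply is_derive_power_series;
          auto using poly_bounded_mult, poly_bounded_int, unit_disc_0.
  - unfold map_convex_in_direction.
    eapply convex_in_direction_ext;
      [ | apply (rotated_image_convex A B (power_series (derive_coef Ac))
                   (power_series (derive_coef Bc)) (alpha + gamma) (/ (1 - b)))]; auto.
    + intros w. split.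
      * intros (u & Hu & ->). exists (cis (- (alpha + gamma)) * u)%C.
        assert (Hz : unit_disc (cis (- (alpha + gamma)) * u))
          by (apply unit_disc_mult_unimodular; auto using Cmod_cis).
        split; [exact Hz | ]. rewrite HT by exact Hz.
        replace (L * (cis (- (alpha + gamma)) * u))%C with u; [reflexivity | ].
        transitivity (cis (- (alpha + gamma)) * L * u)%C; [ | ring].
        unfold L. rewrite cis_opp. ring.
      * intros (z & Hz & ->). exists (L * z)%C.
        split; [now apply unit_disc_mult_unimodular | now apply HT].
    + now apply (disc_shear_open (cos eta) a d A B (power_series (derive_coef Ac))
                 (power_series (derive_coef Bc)) Hm).
    + now apply (disc_shear_horizontal_path (cos eta) a d A B (power_series (derive_coef Ac))
                 (power_series (derive_coef Bc)) Hm).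
Qed.
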